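(* Let $p>1$ and let $u$ be an ancient solution of the half-space problem $u_t-\Delta u=|\nabla u|^p$ in $\mathbb{R}^n_+\times(-\infty,0)$, $u=0$ on $\partial\mathbb{R}^n_+\times(-\infty,0)$. Assume that for each $\varepsilon>0$, $$\sup_{\Gamma_R\times(-\infty,-\varepsilon]}|u|=o(R)\quad\text{as } R\to\infty.$$ Then $u$ is independent of $t$ and depends only on the variable $x_n$.
   Context: $\mathbb{R}^n_+:=\{x\in\mathbb{R}^n: x_n>0\}$ and $\Gamma_R:=\{x\in\mathbb{R}^n: 0<x_n<R\}$. An ancient solution of the half-space problem is a function $u\in C^{2,1}(Q)\cap C(\overline Q)$, $Q=\mathbb{R}^n_+\times(-\infty,0)$, satisfying the PDE pointwise in $Q$ and $u=0$ pointwise on $\partial\mathbb{R}^n_+\times(-\infty,0)$ (no a priori growth restriction, no $C^1$ regularity up to the boundary). *)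

(* Defs.v *)
From HB Require Import structures.
From mathcomp Require Import all_boot all_order all_algebra.
From mathcomp Require Import all_classical all_reals all_analysis.
Set Implicit Arguments. Unset Strict Implicit. Unset Printing Implicit Defensive.
Import Order.TTheory GRing.Theory Num.Theory.
Import numFieldNormedType.Exports.
Local Open Scope classical_set_scope.
Local Open Scope ring_scope.

Section Defs.
Variables (R : realType) (n : nat).
Notation P := ('rV[R]_n.+1 * R)%type.

Definition xlast (x : 'rV[R]_n.+1) : R := x 0 ord_max.

Definition Qset : set P := [set p | 0 < xlast p.1 /\ p.2 < 0].
Definition Qbar : set P := [set p | 0 <= xlast p.1 /\ p.2 <= 0].

Definition ex (i : 'I_n.+1) : P := (delta_mx 0 i, 0).
Definition et : P := (0, 1).

Definition dx (u : P -> R) (i : 'I_n.+1) : P -> R := fun p => 'D_(ex i) u p.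
Definition dt (u : P -> R) : P -> R := fun p => 'D_et u p.

Definition C21_on_Q (u : P -> R) : Prop :=
  forall p, Qset p ->
    [/\ {for p, continuous u},
        derivable u p et /\ {for p, continuous (dt u)},
        (forall i, derivable u p (ex i) /\ {for p, continuous (dx u i)}) &
        (forall i j, derivable (dx u i) p (ex j) /\
                     {for p, continuous (dx (dx u i) j)})].

Definition grad_norm (u : P -> R) (p : P) : R :=
  Num.sqrt (\sum_(i < n.+1) (dx u i p) ^+ 2).

Definition lap (u : P -> R) (p : P) : R := \sum_(i < n.+1) dx (dx u i) i p.

Definition ancient_solution (q : R) (u : P -> R) : Prop :=
  [/\ C21_on_Q u,
      {within Qbar, continuous u},
      (forall p, Qset p -> dt u p - lap u p = powR (grad_norm u p) q) &
      (forall p, xlast p.1 = 0 -> p.2 < 0 -> u p = 0)].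

End Defs.

(* Main.v *)
Require Import Defs.
From HB Require Import structures.
From mathcomp Require Import all_boot all_order all_algebra.
From mathcomp Require Import all_classical all_reals all_analysis.
From mathcomp Require Import ring lra.
Import Order.TTheory GRing.Theory Num.Theory.
Import numFieldNormedType.Exports.
Local Open Scope classical_set_scope.
Local Open Scope ring_scope.
Set Implicit Arguments. Unset Strict Implicit. Unset Printing Implicit Defensive.

(* Comparison: for a translate v = u(. + h) of u and 0 < l < 1, convexity of
   |.|^q makes z = v - l u a subsolution of
     z_t - Lap z <= (1 - l)^(1-q) |grad z|^q,
   which needs no gradient bound on u.  In a strip 0 < x_n < L it is dominated
   by a constant plus (1 - l) times a small multiple of a supersolution with
   bounded gradient; letting l -> 1, sup (v - u) over the strip is at most its
   sup over x_n = 0 and x_n = L.  Hence u is invariant under every shift h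
   parallel to the boundary (in space or time) for which v - u -> 0 uniformly
   as x_n -> oo.

   Decay: put V = ln (3M - u) where |u| <= M = o(x_n) near the point considered.
   A two-point maximum principle for a cutoff times V(x + s e_j, t) - V(x, t),
   minus a multiple of s (a weak form of Bernstein's method, using only second
   derivatives of u), shows that the Lipschitz constant of u in space tends to 0
   as x_n -> oo.  So spatial shifts are allowed; then u depends only on (x_n, t)
   and a parabolic barrier on a unit interval in x_n turns the Lipschitz bound
   into smallness of the oscillation in time. *)

(** * Second-order test and one-dimensional derivatives *)

(** If [d2 > 0], the Carathéodory slope [g] of [f1] at 0 is positive nearby, so [f1 > 0] just to the
    right of 0, and the mean value theorem gives [f b > f 0]. *)
Lemma max_second_derivative (R : realType) (f f1 : R -> R) (d2 e : R) :
  0 < e -> (forall s, `|s| < e -> f s <= f 0) ->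
  (forall s : R, `|s| < e -> is_derive s 1 f (f1 s)) ->
  is_derive (0 : R) 1 f1 d2 -> f1 0 = 0 /\ d2 <= 0.
Proof.
move=> e0 fmax fd f1d.
have fd0 : is_derive (0 : R) 1 f (f1 0) by apply: fd; rewrite normr0.
have inE s : s \in `](- e), e[ -> `|s| < e by rewrite in_itv /= ltr_norml.
have f10 : f1 0 = 0.
  have max0 : is_derive (0 : R) 1 f 0.
    apply: (@derive1_at_max _ f (- e) e 0) => [|s /inE sE||s /inE sE].
    - lra.
    - by have [] := fd _ sE.
    - by rewrite in_itv /=; apply/andP; split; lra.
    - exact: fmax.
  by rewrite -[LHS](@derive_val _ _ _ _ _ _ _ fd0) (@derive_val _ _ _ _ _ _ _ max0).
split=> //; rewrite leNgt; apply/negP => d20.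
have [g [gE gc g0]] := (is_derive1_caratheodory f1 0 d2).1 f1d.
have /nbhs_ballP[r /= r0 rg] : \forall z \near 0, 0 < g z.
  by apply: (cvgr_gt (g 0) gc); rewrite g0.
pose b := Num.min e r / 2.
have m0 : 0 < Num.min e r by rewrite lt_min e0.
have b0 : 0 < b by rewrite /b; lra.
have [be br] : b < e /\ b < r.
  have : b < Num.min e r by rewrite /b; lra.
  by rewrite lt_min => /andP[].
have fder x : x \in `]0, b[ -> is_derive x 1 f (f1 x).
  by rewrite in_itv => /= /andP[x0 xb]; apply: fd; rewrite gtr0_norm //; lra.
have fcont : {within `[0, b], continuous f}.
  apply: derivable_within_continuous => x; rewrite in_itv => /= /andP[x0 xb].
  suff /fd[] : `|x| < e by [].
  by rewrite ger0_norm //; lra.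
have [c] := @MVT _ f f1 0 b b0 fder fcont.
rewrite in_itv /= => /andP[c0 cb] fE.
have f1c : 0 < f1 c.
  have := gE c; rewrite f10 !subr0 => ->; rewrite mulr_gt0 //.
  apply: rg; rewrite /ball /= sub0r normrN gtr0_norm //; lra.
have fb : f b <= f 0 by apply: fmax; rewrite gtr0_norm.
have : 0 < f1 c * (b - 0) by rewrite mulr_gt0 // subr0.
rewrite -fE; lra.
Qed.

(** One-sided, because a maximum over a box may sit at its final time, and one over the separation
    [s] at the right end of its range. *)
Lemma left_max_derivative (R : realType) (f : R -> R) (d e : R) :
  0 < e -> (forall s, - e < s -> s <= 0 -> f s <= f 0) ->
  is_derive (0 : R) 1 f d -> 0 <= d.
Proof.
move=> e0 fmax fd; rewrite leNgt; apply/negP => d0.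
have [g [gE gc g0]] := (is_derive1_caratheodory f 0 d).1 fd.
have /nbhs_ballP[r /= r0 rg] : \forall z \near 0, g z < 0.
  by apply: (cvgr_lt (g 0) gc); rewrite g0.
pose b := Num.min e r / 2.
have m0 : 0 < Num.min e r by rewrite lt_min e0.
have b0 : 0 < b by rewrite /b; lra.
have [be br] : b < e /\ b < r.
  have : b < Num.min e r by rewrite /b; lra.
  by rewrite lt_min => /andP[].
have gb : g (- b) < 0.
  by apply: rg; rewrite /ball /= sub0r opprK gtr0_norm //; lra.
have := gE (- b); rewrite subr0 mulrN => fE.
have : f (- b) <= f 0 by apply: fmax; lra.
have : 0 < - (g (- b) * b) by rewrite -mulNr mulr_gt0 // oppr_gt0.
rewrite -fE; lra.
Qed.

Lemma is_derive_line (R : realType) (V : normedModType R) (f : V -> R) (p v : V)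
    (s : R) : derivable f (p + s *: v) v ->
  is_derive s 1 (fun r => f (p + r *: v)) ('D_v f (p + s *: v)).
Proof.
move=> df.
have E : (fun h : R => h^-1 *: (((fun r => f (p + r *: v)) \o shift s) (h *: 1)
    - f (p + s *: v))) =
  (fun h : R => h^-1 *: ((f \o shift (p + s *: v)) (h *: v) - f (p + s *: v))).
  apply/funext => h /=; congr (_ *: (f _ - _)).
  by rewrite [h *: 1]mulr1 scalerDl addrCA.
by split; rewrite /derivable /derive E.
Qed.

Section pointwise.
Variables (R : realType) (f g : R -> R) (x a b : R).
Hypotheses (fa : is_derive x 1 f a) (gb : is_derive x 1 g b).

(** This rule and the following ones are stated for explicit functions of [s], so that derivatives
    of long expressions can be assembled as a single term and accepted up to conversion. *)
Lemma is_derive1D : is_derive x 1 (fun s => f s + g s) (a + b).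
Proof. exact: is_deriveD. Qed.

Lemma is_derive1B : is_derive x 1 (fun s => f s - g s) (a - b).
Proof. exact: is_deriveB. Qed.

Lemma is_derive1Z (k : R) : is_derive x 1 (fun s => k * f s) (k * a).
Proof. exact: (@is_deriveZ _ _ _ f k). Qed.

Lemma is_derive1M : is_derive x 1 (fun s => f s * g s) (a * g x + f x * b).
Proof.
apply: (is_derive_eq (is_deriveM fa gb)).
by rewrite /GRing.scale /=; ring.
Qed.

Lemma is_derive1V : f x != 0 ->
  is_derive x 1 (fun s => (f s)^-1) (- a / f x ^+ 2).
Proof.
move=> fx0; apply: (is_derive_eq (is_deriveV fx0 fa)).
by rewrite /GRing.scale /= mulrC mulrN mulNr.
Qed.

Lemma is_derive1X (k : nat) :
  is_derive x 1 (fun s => f s ^+ k) (k%:R * f x ^+ k.-1 * a).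
Proof.
have E : (fun s => f s ^+ k) = f ^+ k by apply/funext => s; rewrite fctE.
by rewrite E; exact: (is_deriveX k fa).
Qed.

Lemma is_derive1ln : 0 < f x -> is_derive x 1 (fun s => ln (f s)) (a / f x).
Proof.
move=> fx0.
have h := @is_derive1_comp _ _ f _ _ _ (is_derive1_ln fx0) fa.
by apply: (is_derive_eq h); rewrite mulrC.
Qed.

End pointwise.

(** * Euclidean norm, powers, continuity *)

Section euclidean_norm.
Variables (R : realType) (n : nat).
Implicit Types f g : 'I_n -> R.

(** At [fun i => dx u i p] this is convertible to [grad_norm u p]. *)
Definition enorm f : R := Num.sqrt (\sum_(i < n) f i ^+ 2).

Lemma enorm_ge0 f : 0 <= enorm f. Proof. exact: sqrtr_ge0. Qed.

Lemma enorm_sqr f : enorm f ^+ 2 = \sum_(i < n) f i ^+ 2.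
Proof. by rewrite sqr_sqrtr // sumr_ge0 // => i _; exact: sqr_ge0. Qed.

Lemma eq_enorm f g : f =1 g -> enorm f = enorm g.
Proof. by move=> fg; rewrite /enorm; congr Num.sqrt; apply: eq_bigr => i _; rewrite fg. Qed.

Lemma enormZ (c : R) f : 0 <= c -> enorm (fun i => c * f i) = c * enorm f.
Proof.
move=> c0; rewrite /enorm (eq_bigr (fun i => c ^+ 2 * f i ^+ 2)) => [|i _].
  by rewrite -mulr_sumr sqrtrM ?sqr_ge0 // sqrtr_sqr ger0_norm.
by rewrite exprMn.
Qed.

Lemma enorm_coord f i : `|f i| <= enorm f.
Proof.
rewrite -sqrtr_sqr ler_wsqrtr // (bigD1 i) //= lerDl.
by apply: sumr_ge0 => j _; exact: sqr_ge0.
Qed.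

(** Cauchy-Schwarz: with a and b the two norms, expand the nonnegative sum of the squares (b f_i - a
    g_i)^2 and divide by 2ab; the case of a zero norm is separate. *)
Lemma inner_le_enorm f g : \sum_(i < n) f i * g i <= enorm f * enorm g.
Proof.
have [f0|f0] := eqVneq (enorm f) 0.
  rewrite f0 mul0r big1 // => i _.
  by have := enorm_coord f i; rewrite f0 normr_le0 => /eqP ->; rewrite mul0r.
have [g0|g0] := eqVneq (enorm g) 0.
  rewrite g0 mulr0 big1 // => i _.
  by have := enorm_coord g i; rewrite g0 normr_le0 => /eqP ->; rewrite mulr0.
have fp : 0 < enorm f by rewrite lt_neqAle eq_sym f0 enorm_ge0.
have gp : 0 < enorm g by rewrite lt_neqAle eq_sym g0 enorm_ge0.
set a := enorm f in fp *; set b := enorm g in gp *.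
have : 0 <= \sum_(i < n) (b * f i - a * g i) ^+ 2.
  by apply: sumr_ge0 => i _; exact: sqr_ge0.
rewrite (eq_bigr (fun i => b ^+ 2 * f i ^+ 2 + a ^+ 2 * g i ^+ 2 +
    (- (2 * a * b)) * (f i * g i))) => [|i _]; last by ring.
rewrite !big_split /= -!mulr_sumr -!enorm_sqr -/a -/b.
have -> : b ^+ 2 * a ^+ 2 + a ^+ 2 * b ^+ 2 +
    - (2 * a * b) * \sum_(i < n) f i * g i =
    (2 * a * b) * (a * b - \sum_(i < n) f i * g i) by ring.
by rewrite pmulr_rge0 ?subr_ge0 // !mulr_gt0.
Qed.

Lemma enormD f g : enorm (fun i => f i + g i) <= enorm f + enorm g.
Proof.
rewrite -(@ler_pXn2r _ 2) ?nnegrE ?addr_ge0 ?enorm_ge0 // enorm_sqr.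
rewrite (eq_bigr (fun i => f i ^+ 2 + g i ^+ 2 + 2 * (f i * g i))) => [|i _]; last by ring.
rewrite !big_split /= -mulr_sumr -!enorm_sqr.
have := inner_le_enorm f g; nra.
Qed.

Lemma enorm_bound f (c : R) : 0 <= c -> (forall i, `|f i| <= c) ->
  enorm f <= n%:R * c.
Proof.
move=> c0 fc; rewrite -(@ler_pXn2r _ 2) ?nnegrE ?enorm_ge0 ?mulr_ge0 //.
rewrite enorm_sqr exprMn; apply: (@le_trans _ _ (n%:R * c ^+ 2)).
  rewrite mulr_natl -[X in _ *+ X]card_ord -sumr_const; apply: ler_sum => i _.
  by rewrite -[f i ^+ 2]real_normK ?num_real // ler_pXn2r ?nnegrE.
rewrite ler_wpM2r ?sqr_ge0 // -natrX ler_nat; case: (n) => // m.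
by rewrite expnS expn1 leq_pmulr.
Qed.

End euclidean_norm.

Section powR_facts.
Variables (R : realType) (p : R).

Lemma powR_convex (a b l : R) : 1 < p -> 0 <= a -> 0 <= b -> 0 <= l -> l <= 1 ->
  (l * a + (1 - l) * b) `^ p <= l * a `^ p + (1 - l) * b `^ p.
Proof.
move=> p1 a0 b0 l0 l1.
have i01 : Itv.spec (@Itv.num_sem R) (Itv.Real `[0%Z, 1%Z]) l.
  by rewrite /= /Itv.num_sem /= in_itv /= num_real l0 l1.
have := @convex_powR R p (ltW p1) (Itv.mk i01) a b.
rewrite !convRE /=; apply; by rewrite inE/= in_itv /= andbT.
Qed.

(** Since p > 1, th^(p-1) G^p tends to 0 with [th]; the witness makes it 1/2. This fixes how small a
    multiple of the penalty, with gradient at most [G], is a supersolution in spite of the gradient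
    term. *)
Lemma powR_superlinear_small (G : R) : 1 < p -> 0 < G ->
  exists2 th : R, 0 < th & (th * G) `^ p < th.
Proof.
move=> p1 G0; have p0 : 0 < p - 1 by lra.
have Gp : 0 < G `^ p by rewrite powR_gt0.
pose y := (2 * G `^ p)^-1.
have y0 : 0 < y by rewrite invr_gt0 mulr_gt0.
exists (y `^ (p - 1)^-1); first by rewrite powR_gt0.
set th := y `^ _; have th0 : 0 < th by rewrite powR_gt0.
rewrite powRM ?ltW // -(@mulr_powRB1 _ th p) ?ltW //; last lra.
rewrite /th -powRrM mulVf ?lt0r_neq0 // powRr1 ?ltW // -/th.
rewrite -mulrA gtr_pMr // /y invfM -mulrA mulVf ?gt_eqF // mulr1.
by rewrite invf_lt1 // ltr1n.
Qed.

End powR_facts.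

Section within_continuity.
Variables (T : topologicalType) (R : realType) (A : set T).
Implicit Types f g : T -> R.

Lemma within_continuousB f g : {within A, continuous f} ->
  {within A, continuous g} -> {within A, continuous (fun x => f x - g x)}.
Proof. by move=> cf cg x; apply: cvgB; [exact: cf | exact: cg]. Qed.

Lemma within_continuousM f g : {within A, continuous f} ->
  {within A, continuous g} -> {within A, continuous (fun x => f x * g x)}.
Proof. by move=> cf cg x; apply: cvgM; [exact: cf | exact: cg]. Qed.

Lemma within_continuous_cst (c : R) : {within A, continuous (fun=> c)}.
Proof. by move=> x; exact: cvg_cst. Qed.

Lemma within_continuousZ (c : R) f : {within A, continuous f} ->
  {within A, continuous (fun x => c * f x)}.
Proof. by move=> cf; apply: within_continuousM cf; exact: within_continuous_cst. Qed.

End within_continuity.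

Lemma within_continuous_precomp (S T U : topologicalType) (A : set S) (B : set T)
    (f : T -> U) (g : S -> T) : continuous g -> (forall x, A x -> B (g x)) ->
  {within B, continuous f} -> {within A, continuous (fun x => f (g x))}.
Proof.
move=> gc AB /subspace_continuousP fB; apply/subspace_continuousP => x Ax.
move=> W /= /(fB _ (AB _ Ax)) WB; rewrite /nbhs /=.
have /(gc x) : nbhs (g x) [set y | B y -> W (f y)] by exact: WB.
by rewrite /nbhs /= => gW; apply: filterS gW => y /= + Ay; apply; exact: AB.
Qed.

(** * Maxima over boxes in space-time *)

Section lines.
Variables (R : realType) (n : nat).
Implicit Types p : 'rV[R]_n.+1 * R.

Lemma coord_line_ex p s i k :
  (p + s *: ex R i).1 0 k = p.1 0 k + s * (k == i)%:R.
Proof. by rewrite /= !mxE. Qed.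

Lemma time_line_ex p s (i : 'I_n.+1) : (p + s *: ex R i).2 = p.2.
Proof. by rewrite /= scaler0 addr0. Qed.

Lemma space_line_et p s : (p + s *: et R n).1 = p.1.
Proof. by rewrite /= scaler0 addr0. Qed.

Lemma time_line_et p s : (p + s *: et R n).2 = p.2 + s.
Proof. by rewrite /= /GRing.scale /= mulr1. Qed.

Lemma continuous_coord i : continuous (fun p => p.1 0 i).
Proof.
move=> p; apply: (@cvg_comp _ _ _ fst (fun x : 'rV[R]_n.+1 => x 0 i) _ _ _ cvg_fst).
exact: coord_continuous.
Qed.

Lemma continuous_time : continuous (fun p => p.2).
Proof. by move=> p; exact: cvg_snd. Qed.

End lines.

Section box.
Variables (R : realType) (n : nat).
Notation P := ('rV[R]_n.+1 * R)%type.
Variables (lo hi : 'I_n.+1 -> R) (t0 t1 a b : R).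

Definition box : set P :=
  [set p : P | (forall i, lo i <= p.1 0 i <= hi i) /\ t0 <= p.2 <= t1].

Lemma box_compact : compact box.
Proof.
have -> : box = [set v : 'rV[R]_n.+1 | forall i, `[lo i, hi i]%classic (v ord0 i)] `*`
    `[t0, t1]%classic.
  apply/seteqP; split => p /=.
    by move=> [xp tp]; split; [move=> i; rewrite /= in_itv; exact: xp|rewrite in_itv].
  by move=> [xp tp]; split; [move=> i; have := xp i|move: tp]; rewrite /= in_itv.
apply: compact_setX; last exact: segment_compact.
apply: (@rV_compact R n.+1 (fun i => `[lo i, hi i]%classic)) => i.
exact: segment_compact.
Qed.

(** The parameter [s] is the separation in the two-point argument and runs over the degenerate
    interval [0, 0] in one-point arguments. The final time [t1] is not excluded, hence the one-sided
    conclusion in time. The maximality granted in the last hypothesis serves [time_oscillation],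
    where the lateral faces are excluded by comparison with the centre. *)
Lemma box_max (w : P -> R -> R) (p0 : P) (s0 : R) :
  {within (box `*` `[a, b]%classic), continuous (fun z => w z.1 z.2)} ->
  box p0 -> a <= s0 <= b -> 0 < w p0 s0 ->
  (forall (p : P) (s : R), box p -> a <= s <= b -> 0 < w p s ->
     (forall p', box p' -> w p' s <= w p s) -> (forall i, lo i < p.1 0 i < hi i) /\ t0 < p.2) ->
  exists (p : P) (s : R), [/\ box p, a <= s <= b, 0 < w p s,
      (forall s', a <= s' <= b -> w p s' <= w p s) &
      (forall i, exists2 e, 0 < e &
         forall r, `|r| < e -> w (p + r *: ex R i) s <= w p s) /\
      (exists2 e, 0 < e & forall r, - e < r -> r <= 0 ->
         w (p + r *: et R n) s <= w p s)].
Proof.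
move=> wc p0box s0ab w0 winner.
have cK : compact (box `*` `[a, b]%classic).
  by apply: compact_setX; [exact: box_compact | exact: segment_compact].
have K0 : (box `*` `[a, b]%classic) (p0, s0) by split => //=; rewrite in_itv.
have K00 : box `*` `[a, b]%classic !=set0 by exists (p0, s0).
have [[p s] /set_mem[/= pbox sab] pmax] := compact_EVT_max K00 cK wc.
rewrite in_itv /= in sab.
have {}pmax p' s' : box p' -> a <= s' <= b -> w p' s' <= w p s.
  by move=> ? ?; apply: (pmax (p', s')); rewrite inE; split => //=; rewrite in_itv.
have ws : 0 < w p s by apply: lt_le_trans w0 _; exact: pmax.
have [pin tin] := winner p s pbox sab ws (fun p' pbox' => pmax p' s pbox' sab).
exists p, s; split => //; first by move=> s' ?; exact: pmax.
split=> [i|].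
  have /andP[l h] := pin i.
  exists (Num.min (p.1 0 i - lo i) (hi i - p.1 0 i)).
    by rewrite lt_min !subr_gt0 l.
  move=> r; rewrite lt_min !ltr_norml => /andP[/andP[r1 r2] /andP[r3 r4]].
  apply: pmax => //; split; last by rewrite time_line_ex; case: pbox.
  move=> k; rewrite coord_line_ex; have [->|ki] := eqVneq k i.
    by rewrite mulr1; apply/andP; split; lra.
  by rewrite mulr0 addr0; case: pbox.
exists (p.2 - t0); first by rewrite subr_gt0.
move=> r r1 r2; apply: pmax => //; split.
  by move=> k; rewrite space_line_et; case: pbox.
rewrite time_line_et; case: pbox => _ /andP[? ?]; apply/andP; split; lra.
Qed.

End box.

(** * The solution along coordinate lines *)

Section solution.
Variables (R : realType) (n : nat) (q : R) (u : 'rV[R]_n.+1 * R -> R).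
Notation P := ('rV[R]_n.+1 * R)%type.
Hypothesis usol : ancient_solution q u.

Lemma xlast_line_ex (p : P) s i :
  xlast (p + s *: ex R i).1 = xlast p.1 + s * (i == ord_max)%:R.
Proof. by rewrite /xlast coord_line_ex eq_sym. Qed.

Lemma Qset_line_ex (p : P) s i : Qset p -> `|s| < xlast p.1 ->
  Qset (p + s *: ex R i).
Proof.
move=> [p1 p2]; rewrite ltr_norml => /andP[s1 s2].
split; last by rewrite time_line_ex.
by rewrite xlast_line_ex; case: (_ == _); rewrite ?mulr1 ?mulr0; lra.
Qed.

Lemma is_derive_dx (p : P) s i : Qset (p + s *: ex R i) ->
  is_derive s 1 (fun r => u (p + r *: ex R i)) (dx u i (p + s *: ex R i)).
Proof.
move=> pQ; apply: is_derive_line.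
by case: usol => /(_ _ pQ)[_ _ /(_ i)[]].
Qed.

Lemma is_derive_dxx (p : P) i : Qset p ->
  is_derive (0 : R) 1 (fun r => dx u i (p + r *: ex R i)) (dx (dx u i) i p).
Proof.
move=> pQ; have p0 : p + 0 *: ex R i = p by rewrite scale0r addr0.
rewrite -{2}p0; apply: is_derive_line; rewrite p0.
by case: usol => /(_ _ pQ)[_ _ _ /(_ i i)[]].
Qed.

Lemma is_derive_dt (p : P) : Qset p ->
  is_derive (0 : R) 1 (fun r => u (p + r *: et R n)) (dt u p).
Proof.
move=> pQ; have p0 : p + 0 *: et R n = p by rewrite scale0r addr0.
rewrite -{2}p0; apply: is_derive_line; rewrite p0.
by case: usol => /(_ _ pQ)[_ []].
Qed.

Lemma solution_pde (p : P) : Qset p ->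
  dt u p - lap u p = enorm (fun i => dx u i p) `^ q.
Proof. by case: usol => _ _ + _; apply. Qed.

Lemma solution_bottom (p : P) : xlast p.1 = 0 -> p.2 < 0 -> u p = 0.
Proof. by case: usol => _ _ _; apply. Qed.

Lemma within_continuous_shift (S : topologicalType) (A : set S) (g : S -> P) :
  continuous g -> (forall x, A x -> Qbar (g x)) ->
  {within A, continuous (fun x => u (g x))}.
Proof.
by case: usol => _ uc _ _ gc AQ; exact (@within_continuous_precomp _ _ _ A (@Qbar R n) u g gc AQ uc).
Qed.

End solution.

(** * Comparison in strips *)

Section penalty.
Variables (R : realType) (n : nat) (L : R).
Hypothesis L0 : 0 < L.
Notation P := ('rV[R]_n.+1 * R)%type.

Let C : R := n.+2%:R.

(** The logarithm is unbounded but has bounded slope, and its second derivative is at most 2. In the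
    normal direction the quadratic term, nonnegative for 0 <= r <= L, contributes -2(n+2), which
    outweighs the total 2(n+1) of the logarithms. *)
Definition weight (k : 'I_n.+1) (r : R) : R :=
  ln (1 + r ^+ 2) + (k == ord_max)%:R * C * (L ^+ 2 - r ^+ 2).
Definition weight1 (k : 'I_n.+1) (r : R) : R :=
  2 * r / (1 + r ^+ 2) - (k == ord_max)%:R * C * (2 * r).
Definition weight2 (k : 'I_n.+1) (r : R) : R :=
  (2 * (1 + r ^+ 2) - (2 * r) ^+ 2) / (1 + r ^+ 2) ^+ 2 - (k == ord_max)%:R * C * 2.

(* It tends to infinity in all tangential directions and as time goes to -oo,
   is a strict supersolution of the heat equation, and has bounded gradient. *)
Definition penalty (p : P) : R := \sum_k weight k (p.1 0 k) - p.2.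

Let pos (r : R) : 0 < 1 + r ^+ 2. Proof. by have := sqr_ge0 r; lra. Qed.

Let is_derive_sqr (x s : R) :
  is_derive s 1 (fun r => (x + r) ^+ 2) (2 * (x + s)).
Proof.
have h := is_derive1X (is_derive1D (is_derive_cst x s 1) (is_derive_id s (1 : R))) 2.
by apply: (is_derive_eq h); rewrite /=; ring.
Qed.

Lemma is_derive_weight k (x s : R) :
  is_derive s 1 (fun r => weight k (x + r)) (weight1 k (x + s)).
Proof.
have h1 := is_derive1D (is_derive_cst (1 : R) s 1) (is_derive_sqr x s).
have h2 := is_derive1B (is_derive_cst (L ^+ 2) s 1) (is_derive_sqr x s).
have h := is_derive1D (is_derive1ln h1 (pos _)) (is_derive1Z h2 ((k == ord_max)%:R * C)).
by apply: (is_derive_eq h); rewrite /weight1; ring.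
Qed.

Lemma is_derive_weight1 k (x s : R) :
  is_derive s 1 (fun r => weight1 k (x + r)) (weight2 k (x + s)).
Proof.
have h0 := is_derive1D (is_derive_cst x s 1) (is_derive_id s (1 : R)).
have h1 := is_derive1D (is_derive_cst (1 : R) s 1) (is_derive_sqr x s).
have n0 : 1 + (x + s) ^+ 2 != 0 by rewrite gt_eqF // pos.
have h := is_derive1B (is_derive1M (is_derive1Z h0 2) (is_derive1V h1 n0))
  (is_derive1Z (is_derive1Z h0 2) ((k == ord_max)%:R * C)).
by apply: (is_derive_eq h); rewrite /weight2 /=; field.
Qed.

Lemma weight_ge_ln k (r : R) : (k == ord_max -> 0 <= r <= L) ->
  ln (1 + r ^+ 2) <= weight k r.
Proof.
rewrite /weight lerDl; case: (k == ord_max) => [/(_ isT)/andP[r0 rL]|_].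
  by rewrite mul1r mulr_ge0 ?ler0n // subr_ge0 ler_pXn2r ?nnegrE // ltW.
by rewrite !mul0r.
Qed.

Lemma weight1_bound k (r : R) : (k == ord_max -> 0 <= r <= L) ->
  `|weight1 k r| <= 1 + 2 * C * L.
Proof.
move=> kL; rewrite /weight1; apply: (le_trans (ler_normB _ _)); apply: lerD.
  rewrite normrM normfV [X in _ / X]gtr0_norm ?pos // ler_pdivrMr ?pos // mul1r.
  have := sqr_ge0 (r - 1); have := sqr_ge0 (r + 1).
  by rewrite ler_norml !expr2 => ? ?; apply/andP; split; lra.
case: (k == ord_max) kL => [/(_ isT)/andP[r0 rL]|_]; last first.
  by rewrite !mul0r normr0 !mulr_ge0 ?ler0n // ltW.
rewrite mul1r ger0_norm ?mulr_ge0 ?ler0n // mulrCA mulrA.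
by rewrite ler_wpM2l // mulr_ge0 ?ler0n.
Qed.

Lemma sum_weight2 (x : 'rV[R]_n.+1) : \sum_k weight2 k (x 0 k) <= - 2.
Proof.
have h k : weight2 k (x 0 k) <= 2 - (k == ord_max)%:R * C * 2.
  set r := x 0 k.
  rewrite lerD2r ler_pdivrMr ?exprn_gt0 ?pos //.
  by have := sqr_ge0 r; rewrite exprMn; move: (r ^+ 2) => y y0; nra.
apply: (le_trans (ler_sum _ (fun k _ => h k))).
rewrite big_split /= sumr_const card_ord sumrN (bigD1 ord_max) //= eqxx big1.
  rewrite /C -[X in _ + X <= _]/(- (1 * n.+2%:R * 2 + 0)) -[2 *+ _]mulr_natl.
  by rewrite -[n.+2]addn1 natrD; lra.
by move=> k /negPf ->; rewrite !mul0r.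
Qed.

Lemma continuous_penalty : continuous penalty.
Proof.
move=> p; apply: cvgB; last exact: continuous_time.
apply: cvg_big => [|k _]; first exact: add_continuous.
have ck := @continuous_coord R n k p.
apply: (@cvg_comp _ _ _ (fun p : P => p.1 0 k) (weight k) _ _ _ ck).
have h := is_derive_weight k 0 (p.1 0 k).
have E : (fun r => weight k (0 + r)) = weight k.
  by apply/funext => r; rewrite add0r.
rewrite E in h.
by apply: differentiable_continuous; apply/derivable1_diffP; case: h.
Qed.

Lemma penalty_line_ex p i : exists c : R, forall r : R,
  penalty (p + r *: ex R i) = weight i (p.1 0 i + r) + c.
Proof.
exists (\sum_(k | k != i) weight k (p.1 0 k) - p.2) => r.
rewrite /penalty time_line_ex; under eq_bigr => k _ do rewrite coord_line_ex.
rewrite (bigD1 i) //= eqxx mulr1 addrA; congr (_ + _ - _).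
by apply: eq_bigr => k /negPf ->; rewrite mulr0 addr0.
Qed.

Lemma penalty_line_et p (r : R) : penalty (p + r *: et R n) = penalty p - r.
Proof. by rewrite /penalty time_line_et space_line_et opprD addrA. Qed.

Section strip.
Variable p : P.
Hypotheses (pL : 0 <= xlast p.1 <= L) (pt : p.2 <= 0).

Let weight_ge0 k : ln (1 + p.1 0 k ^+ 2) <= weight k (p.1 0 k).
Proof. by apply: weight_ge_ln => /eqP ->. Qed.

Let ln_ge0 (r : R) : 0 <= ln (1 + r ^+ 2).
Proof. by apply: ln_ge0; rewrite lerDl sqr_ge0. Qed.

(** Together with [penalty_ge_ln], this confines the part of the strip where the penalty is below a
    given level to a bounded box. *)
Lemma penalty_ge_time : - p.2 <= penalty p.
Proof.
rewrite lerDr; apply: sumr_ge0 => k _; exact: le_trans (weight_ge0 _).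
Qed.

Lemma penalty_ge_ln k : ln (1 + p.1 0 k ^+ 2) <= penalty p.
Proof.
rewrite /penalty (bigD1 k) //= -addrA; apply: (le_trans (weight_ge0 k)).
rewrite lerDl addr_ge0 ?oppr_ge0 //.
by apply: sumr_ge0 => j _; exact: le_trans (weight_ge0 _).
Qed.

End strip.
End penalty.

(** The contradiction at the maximum for z = u(. + h) - l u: the derivative tests give z_t - Lap z
    >= eta, while the equation and convexity give z_t - Lap z <= (1 - l) [cq] < eta. *)
Fact comparison_arith (R : realType) (dta dtp la lp aq bq cq l eta : R) :
  0 <= dta - l * dtp + eta -> la - l * lp <= - (2 * eta) ->
  aq <= l * bq + (1 - l) * cq -> (1 - l) * cq < eta ->
  dta - la = aq -> dtp - lp = bq -> False.
Proof. by move=> h1 h2 h3 h4 ea eb; rewrite -ea -eb in h3; lra. Qed.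

Section strip_comparison.
Variables (R : realType) (n : nat) (q : R) (u : 'rV[R]_n.+1 * R -> R).
Notation P := ('rV[R]_n.+1 * R)%type.
Hypotheses (q1 : 1 < q) (usol : ancient_solution q u).
Variables (h : P) (L M kap tau : R).
Hypotheses (h0 : xlast h.1 = 0) (tau0 : tau < 0) (tauh : tau + h.2 < 0).
Hypotheses (L0 : 0 < L) (kap0 : 0 <= kap).
Hypothesis uM : forall p : P, 0 <= xlast p.1 <= L -> p.2 <= tau ->
  `|u p| <= M /\ `|u (p + h)| <= M.
Hypothesis lateral : forall p : P, xlast p.1 = L -> p.2 <= tau ->
  u (p + h) - u p <= kap.

Let xlast_shift (p : P) : xlast (p + h).1 = xlast p.1.
Proof. by move: h0; rewrite /xlast /= mxE => ->; rewrite addr0. Qed.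

Let shift_line (p v : P) (r : R) : p + r *: v + h = p + h + r *: v.
Proof. by rewrite addrAC. Qed.

Let G : R := n.+1%:R * (1 + 2 * n.+2%:R * L).

Let G0 : 0 < G.
Proof.
by rewrite mulr_gt0 ?ltr0Sn // ltr_pwDl ?ltr01 // !mulr_ge0 ?ler0n // ltW.
Qed.

(** The difference [w] of the two sides cannot be positive on the faces of the strip: at x_n = 0
    both values of u vanish, and at x_n = L the terms [kap] and (1 - l) M cover u(. + h) - u and (1
    - l) u. The penalty confines positive values to a bounded box, so a positive maximum would be
    interior in space, where the equation forbids it. *)
Lemma scaled_comparison (l th : R) (p0 : P) : 0 < l < 1 -> 0 < th ->
  (th * G) `^ q < th -> 0 <= xlast p0.1 <= L -> p0.2 <= tau ->
  u (p0 + h) - l * u p0 <= (1 - l) * M + kap + (1 - l) * th * penalty L p0.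
Proof.
move: (tau0) (tauh) (L0) (kap0) => tauN tauhN Lp kapp.
move=> /andP[l0 l1] th0 thG p0L p0t; rewrite leNgt; apply/negP => p0pos.
pose eta := (1 - l) * th.
have eta0 : 0 < eta by rewrite mulr_gt0 // subr_gt0.
pose w (p : P) (s : R) :=
  u (p + h) - l * u p - ((1 - l) * M + kap) - eta * penalty L p.
have wp0 : 0 < w p0 0 by rewrite /w /eta; move: p0pos; lra.
(* Where [w > 0], the bounds on u force the penalty below [D]; then 1 + x_i^2 < exp D and -t < D, so
   [B] bounds all coordinates and the time. *)
pose D := 2 * M / eta.
pose B := expR D + D + L + - tau.
have M0 : 0 <= M by have [] := uM p0L p0t; have := normr_ge0 (u p0); lra.
have D0 : 0 <= D by apply: divr_ge0; [rewrite mulr_ge0|exact: ltW].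
have eD : 1 <= expR D by rewrite -expR0 ler_expR.
have inner (p : P) : 0 <= xlast p.1 <= L -> p.2 <= tau -> 0 < w p 0 ->
    [/\ 0 < xlast p.1 < L, (forall i, - B < p.1 0 i < B) & - B < p.2].
  move=> pL pt wp; have p20 : p.2 <= 0 by lra.
  have [/ler_normlP[b1 b2] /ler_normlP[b3 b4]] := uM pL pt.
  have phiD : penalty L p < D.
    rewrite ltr_pdivlMr // mulrC; move: wp; rewrite /w.
    have : l * u p >= - (l * M) by rewrite -mulrN ler_pM2l //; lra.
    have : l * M <= M by rewrite ler_piMl // ltW.
    lra.
  split.
  - have [pl ph] := andP pL; rewrite !lt_neqAle pl ph !andbT; apply/andP.
    have pen0 : 0 <= eta * penalty L p.
      apply: mulr_ge0; first exact: ltW.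
      by apply: (le_trans _ (penalty_ge_time L0 pL)); lra.
    have lu : (1 - l) * u p <= (1 - l) * M by rewrite ler_wpM2l //; lra.
    split; apply/eqP => pE.
      have e1 : u p = 0 by apply: (solution_bottom usol); [rewrite -pE|lra].
      have e2 : u (p + h) = 0.
        by apply: (solution_bottom usol); [rewrite xlast_shift -pE|rewrite /=; lra].
      by move: wp; rewrite /w e1 e2; rewrite e1 in lu; lra.
    have := lateral pE pt; move: wp; rewrite /w; lra.
  - move=> i; have := le_lt_trans (penalty_ge_ln L0 pL p20 i) phiD.
    have x2 := sqr_ge0 (p.1 0 i).
    rewrite -ltr_expR lnK ?posrE; last by lra.
    rewrite /B => xD; rewrite -ltr_norml.
    rewrite ltNge; apply/negP => Bx.
    have : `|p.1 0 i| ^+ 2 < expR D by rewrite real_normK ?num_real //; lra.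
    rewrite expr2; have : expR D <= `|p.1 0 i| by lra.
    nra.
  - have := le_lt_trans (penalty_ge_time L0 pL) phiD.
    rewrite /B; lra.
pose lo (i : 'I_n.+1) : R := if i == ord_max then 0 else - B.
pose hi (i : 'I_n.+1) : R := if i == ord_max then L else B.
have box_strip p : box lo hi (- B) tau p -> 0 <= xlast p.1 <= L /\ p.2 <= tau.
  move=> [/(_ ord_max)]; rewrite /lo /hi eqxx => -> /andP[_ ->]; by split.
have wc : {within box lo hi (- B) tau `*` `[0 : R, 0]%classic,
    continuous (fun z => w z.1 z.2)}.
  have cf : continuous (@fst P R) by move=> z; exact: cvg_fst.
  apply: within_continuousB; first apply: within_continuousB.
  - apply: within_continuousB.
      apply: (within_continuous_shift usol) => [z|[p s] [/= /box_strip[pL pt] _]].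
        by apply: cvgD; [exact: cf|exact: cvg_cst].
      split; first by rewrite xlast_shift; case/andP: pL.
      by rewrite /=; lra.
    apply: within_continuousZ; apply: (within_continuous_shift usol) => //.
    move=> [p s] [/= /box_strip[/andP[pL _] pt] _]; split => //=; lra.
  - exact: within_continuous_cst.
  - apply: within_continuousZ; apply: continuous_subspaceT => z.
    apply: (@cvg_comp _ _ _ fst (penalty L) _ _ _ (cf z)).
    exact: continuous_penalty.
have p0box : box lo hi (- B) tau p0.
  have [/andP[a1 a2] a3 a4] := inner _ p0L p0t wp0.
  split => [i|]; last by rewrite p0t ltW.
  rewrite /lo /hi; case: eqP => [->|_]; first exact: p0L.
  by have /andP[? ?] := a3 i; rewrite !ltW.
have winner p s : box lo hi (- B) tau p -> 0 <= s <= 0 -> 0 < w p s ->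
    (forall p', box lo hi (- B) tau p' -> w p' s <= w p s) -> (forall i, lo i < p.1 0 i < hi i) /\ - B < p.2.
  move=> /box_strip[pL pt] _ wp _; have [a1 a2 a3] := inner _ pL pt wp.
  split=> // i; rewrite /lo /hi; case: eqP => [->|_] //; exact: a2.
have s00 : 0 <= (0 : R) <= 0 by rewrite lexx.
have [p [s [pbox sab ws _ [wx [et0 et00 wt]]]]] := box_max wc p0box s00 wp0 winner.
have [pL pt] := box_strip p pbox.
have [/andP[xl xL] _ _] := inner p pL pt ws.
have pQ : Qset p by split => //; lra.
have phQ : Qset (p + h) by split; [rewrite xlast_shift|rewrite /=; lra].
have space i : dx u i (p + h) = l * dx u i p + eta * weight1 i (p.1 0 i) /\
    dx (dx u i) i (p + h) - l * dx (dx u i) i p - eta * weight2 i (p.1 0 i) <= 0.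
  have [e e0 we] := wx i.
  have [c cE] := penalty_line_ex L p i.
  pose f (r : R) := u (p + h + r *: ex R i) - l * u (p + r *: ex R i) -
    ((1 - l) * M + kap) - eta * (weight L i (p.1 0 i + r) + c).
  pose f1 (r : R) := dx u i (p + h + r *: ex R i) - l * dx u i (p + r *: ex R i) -
    0 - eta * (weight1 i (p.1 0 i + r) + 0).
  have fE r : w (p + r *: ex R i) s = f r by rewrite /w cE shift_line.
  have f0 : w p s = f 0 by rewrite -fE scale0r addr0.
  have [||||] := @max_second_derivative _ f f1
    (dx (dx u i) i (p + h) - l * dx (dx u i) i p - 0 -
      eta * (weight2 i (p.1 0 i + 0) + 0)) (Num.min e (xlast p.1)).
  - by rewrite lt_min e0.
  - by move=> r; rewrite lt_min => /andP[re _]; rewrite -f0 -fE; exact: we.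
  - move=> r; rewrite lt_min => /andP[_ rx].
    have Q1 : Qset (p + h + r *: ex R i).
      by apply: Qset_line_ex => //; rewrite xlast_shift.
    have Q2 : Qset (p + r *: ex R i) by exact: Qset_line_ex.
    have d1 := is_derive_dx usol Q1; have d2 := is_derive_dx usol Q2.
    exact: (is_derive1B (is_derive1B (is_derive1B d1 (is_derive1Z d2 l))
      (is_derive_cst _ _ _)) (is_derive1Z (is_derive1D (is_derive_weight L i _ _)
      (is_derive_cst _ _ _)) eta)).
  - exact: (is_derive1B (is_derive1B (is_derive1B (is_derive_dxx usol i phQ)
      (is_derive1Z (is_derive_dxx usol i pQ) l)) (is_derive_cst _ _ _))
      (is_derive1Z (is_derive1D (is_derive_weight1 i _ _)
      (is_derive_cst _ _ _)) eta)).
  - rewrite /f1 !scale0r !addr0 !subr0 => f10 f2; split => //.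
    by rewrite -(subr0_eq f10); ring.
have time : 0 <= dt u (p + h) - l * dt u p + eta.
  pose f (r : R) := u (p + h + r *: et R n) - l * u (p + r *: et R n) -
    ((1 - l) * M + kap) - eta * (penalty L p - r).
  have fE r : w (p + r *: et R n) s = f r by rewrite /w penalty_line_et shift_line.
  have f0 : w p s = f 0 by rewrite -fE scale0r addr0.
  have := @left_max_derivative _ f
    (dt u (p + h) - l * dt u p - 0 - eta * (0 - 1)) et0 et00.
  rewrite !subr0 sub0r mulrN1 opprK; apply.
    by move=> r r1 r2; rewrite -f0 -fE; exact: wt.
  have h1 := is_derive1B (is_derive1B (is_derive1B (is_derive_dt usol phQ)
    (is_derive1Z (is_derive_dt usol pQ) l)) (is_derive_cst ((1 - l) * M + kap) (0 : R) 1))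
    (is_derive1Z (is_derive1B (is_derive_cst (penalty L p) (0 : R) 1)
      (is_derive_id (0 : R) 1)) eta).
  by apply: (is_derive_eq h1); ring.
have lapE : lap u (p + h) - l * lap u p <= - (2 * eta).
  apply: (@le_trans _ _ (eta * \sum_k weight2 k (p.1 0 k))).
    rewrite /lap !mulr_sumr -sumrB; apply: ler_sum => i _.
    by rewrite -subr_le0; case: (space i).
  have := sum_weight2 p.1; rewrite [X in _ -> _ <= X](_ : _ = eta * - 2); last by ring.
  by rewrite ler_pM2l.
have weight_norm : enorm (fun i => weight1 i (p.1 0 i)) <= G.
  apply: enorm_bound => [|i].
    by rewrite addr_ge0 // !mulr_ge0 ?ler0n // ltW.
  by apply: weight1_bound => // /eqP ->.
(* The first-order condition expresses the gradient at [p + h] with weights l and 1 - l through the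
   gradient at [p] and [th] times that of the penalty. Convexity of the power then applies however
   large the gradient of u is. *)
have grad : enorm (fun i => dx u i (p + h)) <=
    l * enorm (fun i => dx u i p) + (1 - l) * (th * G).
  rewrite (@eq_enorm _ _ _ (fun i => l * dx u i p + eta * weight1 i (p.1 0 i)));
    last by move=> i; case: (space i).
  apply: (le_trans (enormD _ _)); rewrite !enormZ ?(ltW l0) ?(ltW eta0) //.
  rewrite lerD2l /eta -mulrA ler_pM2l ?subr_gt0 // ler_pM2l //.
have := solution_pde usol pQ; have := solution_pde usol phQ.
set a := enorm _ in grad *; set b := enorm _ in grad *.
have a0 : 0 <= a := enorm_ge0 _; have b0 : 0 <= b := enorm_ge0 _.
have tG0 : 0 <= th * G by rewrite mulr_ge0 // ltW.
have conv := @powR_convex _ q b (th * G) l q1 b0 tG0 (ltW l0) (ltW l1).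
have aq : a `^ q <= (l * b + (1 - l) * (th * G)) `^ q.
  apply: ge0_ler_powR; rewrite ?nnegrE //; first exact: ltW (lt_trans ltr01 q1).
  by apply: addr_ge0; apply: mulr_ge0; rewrite ?subr_ge0 // ltW.
have : (1 - l) * (th * G) `^ q < eta by rewrite /eta ltr_pM2l // subr_gt0.
move=> s1 s2 s3.
exact: comparison_arith time lapE (le_trans aq conv) s1 s2 s3.
Qed.

Lemma strip_comparison (p : P) : 0 <= xlast p.1 <= L -> p.2 <= tau ->
  u (p + h) - u p <= kap.
Proof.
move: (tau0) => tauN pL pt; have [th th0 thG] := powR_superlinear_small q1 G0.
apply/ler_addgt0Pr => e e0.
have M0 : 0 <= M by have [] := uM pL pt; have := normr_ge0 (u p); lra.
have pen0 : 0 <= penalty L p.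
  by apply: (le_trans _ (penalty_ge_time L0 pL)); lra.
(* With 1 - l = e / K, the terms carrying the factor 1 - l, at most (1 - l)(2 M + th penalty) in
   total, stay below e; the summand 2 e keeps K positive and l positive. *)
pose K := 2 * M + th * penalty L p + 2 * e.
have K0 : 0 < K.
  by rewrite /K; have := mulr_ge0 (ltW th0) pen0; lra.
pose l := 1 - e / K.
have eK : 0 < e / K by rewrite divr_gt0.
have eK1 : e / K < 1.
  rewrite ltr_pdivrMr // mul1r /K; have := mulr_ge0 (ltW th0) pen0; lra.
have l01 : 0 < l < 1 by rewrite /l; apply/andP; split; lra.
have := scaled_comparison l01 th0 thG pL pt.
have -> : 1 - l = e / K by rewrite /l; ring.
have [/ler_normlP[b1 b2] _] := uM pL pt.
have -> : u (p + h) - l * u p = u (p + h) - u p + (e / K) * u p by rewrite /l; ring.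
have : e / K * (- u p) <= e / K * M by rewrite ler_pM2l.
have : e / K * K = e by rewrite divfK // gt_eqF.
rewrite {2}/K; have := mulr_gt0 eK e0; nra.
Qed.

End strip_comparison.

(** * Two-point Bernstein estimate *)

Section log_transform.
Variables (R : realType) (n : nat) (q : R) (u : 'rV[R]_n.+1 * R -> R) (K : R).
Notation P := ('rV[R]_n.+1 * R)%type.
Hypothesis usol : ancient_solution q u.

Definition logu (p : P) : R := ln (K - u p).
Definition logu_x (i : 'I_n.+1) (p : P) : R := - dx u i p / (K - u p).
Definition logu_xx (i : 'I_n.+1) (p : P) : R :=
  - dx (dx u i) i p / (K - u p) - logu_x i p ^+ 2.
Definition logu_t (p : P) : R := - dt u p / (K - u p).

Lemma is_derive_logu_ex (p : P) s i : Qset (p + s *: ex R i) ->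
  u (p + s *: ex R i) < K ->
  is_derive s 1 (fun r => logu (p + r *: ex R i)) (logu_x i (p + s *: ex R i)).
Proof.
move=> pQ pK.
have h1 := is_derive1B (is_derive_cst K s 1) (is_derive_dx usol pQ).
have h2 := is_derive1ln h1; rewrite subr_gt0 in h2.
by apply: (is_derive_eq (h2 pK)); rewrite sub0r.
Qed.

Lemma is_derive_logu_x (p : P) i : Qset p -> u p < K ->
  is_derive (0 : R) 1 (fun r => logu_x i (p + r *: ex R i)) (logu_xx i p).
Proof.
move=> pQ pK; have p0 : p + 0 *: ex R i = p by rewrite scale0r addr0.
have h0 : is_derive (0 : R) 1 (fun r => u (p + r *: ex R i)) (dx u i p).
  by rewrite -{2}p0; apply: (is_derive_dx usol); rewrite p0.
have h1 := is_derive1B (is_derive_cst K (0 : R) 1) h0.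
have n0 : K - u (p + 0 *: ex R i) != 0 by rewrite p0 subr_eq0 gt_eqF.
have n0' : K - u p != 0 by rewrite -{1}p0.
have h := is_derive1M (is_derive1Z (is_derive_dxx usol i pQ) (-1)) (is_derive1V h1 n0).
have E : (fun r => logu_x i (p + r *: ex R i)) = (fun r =>
    -1 * dx u i (p + r *: ex R i) * (K - u (p + r *: ex R i))^-1).
  by apply/funext => r; rewrite /logu_x mulN1r.
by rewrite E; apply: (is_derive_eq h); rewrite /= !p0 /logu_xx /logu_x; field.
Qed.

Lemma is_derive_logu_et (p : P) : Qset p -> u p < K ->
  is_derive (0 : R) 1 (fun r => logu (p + r *: et R n)) (logu_t p).
Proof.
move=> pQ pK; have p0 : p + 0 *: et R n = p by rewrite scale0r addr0.
have h1 := is_derive1B (is_derive_cst K (0 : R) 1) (is_derive_dt usol pQ).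
have h2 := is_derive1ln h1; rewrite p0 subr_gt0 in h2.
by apply: (is_derive_eq (h2 pK)); rewrite sub0r.
Qed.

(** With v = K - u and V = ln v one has |grad u| = v |grad V|, so |grad u|^q / v equals v^(q-1)
    |grad V|^q; the square comes from the concavity of the logarithm. The coefficient v^(q-1)
    increases with V, which is the source of the gain in the two-point argument. *)
Lemma logu_pde (p : P) : 0 < q -> Qset p -> u p < K ->
  logu_t p - \sum_i logu_xx i p = enorm (fun i => logu_x i p) ^+ 2 -
    (K - u p) `^ (q - 1) * enorm (fun i => logu_x i p) `^ q.
Proof.
move=> q0 pQ pK; set v := K - u p; set E := enorm _.
have v0 : 0 < v by rewrite subr_gt0.
have := solution_pde usol pQ.
have -> : enorm (fun i => dx u i p) = v * E.
  rewrite -enormZ ?ltW // /enorm; congr Num.sqrt; apply: eq_bigr => i _.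
  by rewrite /logu_x -/v mulNr mulrN sqrrN mulrCA divff ?mulr1 // gt_eqF.
rewrite powRM ?enorm_ge0 ?(ltW v0) // => pde.
rewrite /logu_xx sumrB /E enorm_sqr -/E -/v.
rewrite -mulr_suml sumrN -/(lap u p).
have -> : v `^ (q - 1) * E `^ q = v^-1 * (v `^ q * E `^ q).
  by rewrite -(@mulr_powRB1 _ v q) ?ltW // -mulrA mulKf // gt_eqF.
by rewrite -pde /logu_t -/v; field; rewrite gt_eqF.
Qed.

End log_transform.

Section bernstein_inequality.
Variables (R : realType) (q : R) (k : nat) (D g rho Lam C1 A B va vb M : R).

(* The gain [va^(q-1) A^q - vb^(q-1) B^q] of the nonlinearity is proportional
   to [D], since [vb = va exp(-D)] and [B <= A (1 + O(D))]. *)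
Lemma bernstein_inequality :
  1 < q -> 1 <= k%:R * (q - 1) -> (0 < k)%N -> 1 <= Lam ->
  4 * k%:R * q <= Lam * (q - 1) ->
  0 < D <= 1 -> 0 < g <= 1 -> 0 < rho -> 0 <= C1 -> 0 < M ->
  0 <= B -> Lam / (rho * g ^+ k) <= A ->
  B <= A + D * (2 * k%:R / (rho * g)) -> A <= B + D * (2 * k%:R / (rho * g)) ->
  2 * M <= va -> vb = va * expR (- D) ->
  C1 + 4 * k%:R < (q - 1) / (q + 1) * rho * (2 * M * Lam / rho) `^ (q - 1) ->
  A ^+ 2 - B ^+ 2 - va `^ (q - 1) * A `^ q + vb `^ (q - 1) * B `^ q <
    - (D * (C1 / (rho ^+ 2 * g ^+ 2))).
Proof.
move=> q1 kq k0 Lam1 Lamq /andP[D0 D1] /andP[g0 g1] rho0 C10 M0 B0 LA BA AB vaM vbE big.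
have q0 : 0 < q by lra.
have va0 : 0 < va by lra.
have k1 : 1 <= k%:R :> R by rewrite ler1n.
have rg0 : 0 < rho * g by rewrite mulr_gt0.
have gk0 : 0 < g ^+ k by rewrite exprn_gt0.
have gkg : g ^+ k <= g by rewrite -[leRHS]expr1 ler_wiXn2l // ltW.
have rgk0 : 0 < rho * g ^+ k by rewrite mulr_gt0.
have LA' : Lam / (rho * g) <= A.
  apply: le_trans LA; rewrite ler_pM2l; last by lra.
  by rewrite lef_pV2 ?posrE // ler_pM2l.
set z := (rho * g)^-1 in LA'.
have z0 : 0 < z by rewrite invr_gt0.
have zA : z <= A by apply: le_trans LA'; rewrite ler_peMl // ltW.
have A0 : 0 < A by lra.
have zE : 2 * k%:R / (rho * g) = 2 * k%:R * z by [].
rewrite zE in BA AB.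
(* With this [y], vb^(q-1) = va^(q-1) exp(-2y), while [Lamq] and the lower bound on [A] give B^q <=
   A^q exp(y). Half of the gain thus pays for the change of gradient. *)
pose y := (q - 1) / 2 * D.
have y0 : 0 < y by rewrite /y mulr_gt0 // divr_gt0 // subr_gt0.
have BAq : B `^ q <= A `^ q * expR y.
  have BA1 : B <= A * (1 + y / q).
    apply: (le_trans BA); rewrite mulrDr mulr1 lerD2l.
    have -> : A * (y / q) = D * ((q - 1) / (2 * q) * A) by rewrite /y; field; rewrite gt_eqF.
    rewrite ler_pM2l //.
    have : (q - 1) / (2 * q) * (Lam * z) <= (q - 1) / (2 * q) * A.
      by rewrite ler_pM2l // divr_gt0 ?mulr_gt0 // subr_gt0.
    apply: le_trans; rewrite mulrA ler_pM2r // mulrAC ler_pdivlMr ?mulr_gt0 //.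
    by move: Lamq; lra.
  have yq0 : 0 <= 1 + y / q by rewrite addr_ge0 // divr_ge0 // ltW.
  apply: (@le_trans _ _ ((A * (1 + y / q)) `^ q)).
    by apply: ge0_ler_powR; rewrite ?nnegrE ?mulr_ge0 // ltW.
  rewrite powRM ?(ltW A0) // ler_pM2l ?powR_gt0 //.
  have -> : expR y = expR (y / q) `^ q by rewrite -expRM divfK // gt_eqF.
  apply: ge0_ler_powR; rewrite ?nnegrE ?expR_ge0 //; first exact: ltW.
  exact: expR_ge1Dx.
set W := va `^ (q - 1).
have W0 : 0 < W by rewrite powR_gt0.
have vbW : vb `^ (q - 1) = W * expR (- (2 * y)).
  rewrite vbE powRM ?expR_ge0 ?(ltW va0) // -expRM; congr (_ * expR _).
  by rewrite /y; field.
have Aq0 : 0 < A `^ q by rewrite powR_gt0.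
have gain : vb `^ (q - 1) * B `^ q <= W * A `^ q * expR (- y).
  rewrite vbW -!mulrA ler_pM2l // mulrC.
  have -> : expR (- y) = expR y * expR (- (2 * y)) by rewrite -expRD; congr expR; ring.
  by rewrite mulrA ler_pM2r ?expR_gt0.
(* This is the value of y / (1 + y) at D = 1. That quotient is concave in D and vanishes at 0, so
   exp(-y) <= 1 / (1 + y) <= 1 - D m on [0, 1]. *)
pose m := (q - 1) / (q + 1).
have m0 : 0 < m by rewrite divr_gt0 //; lra.
have eyD : expR (- y) <= 1 - D * m.
  have h : (1 + y) * expR (- y) <= 1.
    by rewrite -[leRHS](expRxMexpNx_1 y) ler_pM2r ?expR_gt0 // expR_ge1Dx.
  have : 1 <= (1 + y) * (1 - D * m).
    have mE : m * (q + 1) = q - 1 by rewrite /m divfK // gt_eqF //; lra.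
    have -> : (1 + y) * (1 - D * m) = 1 + D * ((q - 1) / 2 - m * (1 + (q - 1) / 2 * D)).
      by rewrite /y; ring.
    rewrite lerDl mulr_ge0 ?(ltW D0) // subr_ge0.
    have : m * (1 + (q - 1) / 2 * D) <= m * (1 + (q - 1) / 2).
      rewrite ler_pM2l // lerD2l ler_piMr //; lra.
    have -> : m * (1 + (q - 1) / 2) = (m * (q + 1)) / 2 by field.
    by rewrite mE; lra.
  move=> h'; have := le_trans h h'; rewrite ler_pM2l //; lra.
have loss : A ^+ 2 - B ^+ 2 <= D * (4 * k%:R * z * A).
  have [BleA|AltB] := leP B A.
    have -> : A ^+ 2 - B ^+ 2 = (A - B) * (A + B) by ring.
    apply: (@le_trans _ _ ((D * (2 * k%:R * z)) * (2 * A))); last by lra.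
    apply: ler_pM; rewrite ?subr_ge0 //; last by lra.
      exact: addr_ge0 (ltW A0) B0.
    by rewrite lerBlDl.
  have : 0 <= D * (4 * k%:R * z * A) by rewrite !mulr_ge0 // ltW.
  have : A ^+ 2 <= B ^+ 2 by rewrite ler_pXn2r ?nnegrE // ltW.
  lra.
have AqE : A `^ q = A * A `^ (q - 1) by rewrite mulr_powRB1 // ltW.
(* Here the exponent of the cutoff matters: k (q - 1) >= 1 and g <= 1 make g^(-k(q-1)) at least 1/g,
   enough to beat the errors of order 1/g. *)
have Aq1 : (Lam / rho) `^ (q - 1) / g <= A `^ (q - 1).
  have L0 : 0 < Lam by lra.
  apply: (@le_trans _ _ ((Lam / (rho * g ^+ k)) `^ (q - 1))); last first.
    have L1 : 0 <= Lam / (rho * g ^+ k) by apply: divr_ge0; exact: ltW.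
    by apply: ge0_ler_powR; rewrite ?nnegrE // ltW // subr_gt0.
  rewrite invfM mulrA (@powRM _ (Lam / rho)); last 2 first.
  - by apply: divr_ge0; exact: ltW.
  - by rewrite invr_ge0 ltW.
  rewrite ler_pM2l ?powR_gt0 ?divr_gt0 //.
  have -> : (g ^+ k)^-1 = g^-1 `^ k%:R by rewrite powR_mulrn ?invr_ge0 ?(ltW g0) // exprVn.
  have g1' : 1 <= g^-1 by rewrite invf_ge1.
  rewrite -powRrM -{1}[g^-1]powRr1 ?invr_ge0 ?(ltW g0) //.
  exact: ler_powR.
have M20 : 0 < 2 * M by rewrite mulr_gt0.
have Lr0 : 0 < Lam / rho by rewrite divr_gt0 // (lt_le_trans ltr01).
have WM : (2 * M) `^ (q - 1) <= W.
  by apply: ge0_ler_powR; rewrite ?nnegrE ?subr_ge0 ?(ltW q1) ?(ltW M20) ?(ltW va0).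
have big' : (C1 + 4 * k%:R) * z < W * m * A `^ (q - 1).
  apply: (@lt_le_trans _ _ ((2 * M) `^ (q - 1) * m * ((Lam / rho) `^ (q - 1) / g))).
    have -> : (2 * M) `^ (q - 1) * m * ((Lam / rho) `^ (q - 1) / g) =
        (m * rho * (2 * M * Lam / rho) `^ (q - 1)) * z.
      rewrite -[2 * M * Lam / rho]mulrA (@powRM _ (2 * M)) ?(ltW Lr0) ?(ltW M20) //.
      by rewrite /z; field; rewrite !gt_eqF.
    by rewrite ltr_pM2r.
  apply: ler_pM => //; last by rewrite ler_pM2r.
    by apply: mulr_ge0; [exact: powR_ge0|exact: ltW].
  by apply: divr_ge0; [exact: powR_ge0|exact: ltW].
have big2 : (C1 + 4 * k%:R) * z * A < W * m * A `^ q.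
  by rewrite AqE [A * _]mulrC mulrA ltr_pM2r.
have C1z : C1 / (rho ^+ 2 * g ^+ 2) <= C1 * z * A.
  rewrite -exprMn invfM -expr2 -/z -mulrA ler_wpM2l // expr2 ler_pM2l //.
have WAe : W * A `^ q * expR (- y) <= W * A `^ q * (1 - D * m).
  by rewrite ler_pM2l ?mulr_gt0.
have fin : D * (4 * k%:R * z * A + C1 / (rho ^+ 2 * g ^+ 2)) < D * (W * m * A `^ q).
  rewrite ltr_pM2l //; move: big2 C1z; clear; set X := C1 / _; lra.
move: loss gain WAe fin; clear; set X := C1 / _; lra.
Qed.

End bernstein_inequality.

Lemma is_derive1VX (R : realType) (f : R -> R) (x a : R) (k : nat) :
  is_derive x 1 f a -> f x != 0 ->
  is_derive x 1 (fun s => (f s)^-1 ^+ k) (- k%:R * a * (f x)^-1 ^+ k.+1).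
Proof.
move=> fa fx0; apply: (is_derive_eq (is_derive1X (is_derive1V fa fx0) k)).
case: k => [|k]; first by rewrite oppr0 !mul0r.
by rewrite -exprVn /= !exprS; ring.
Qed.

Lemma within_continuous_ln (T : topologicalType) (R : realType) (A : set T)
    (f : T -> R) : (forall x, A x -> 0 < f x) -> {within A, continuous f} ->
  {within A, continuous (fun x => ln (f x))}.
Proof.
move=> f0 /subspace_continuousP fc; apply/subspace_continuousP => x Ax.
exact: (cvg_comp _ _ (fc x Ax) (continuous_ln (f0 x Ax))).
Qed.

Section two_point.
Variables (R : realType) (n : nat) (q : R) (u : 'rV[R]_n.+1 * R -> R).
Notation P := ('rV[R]_n.+1 * R)%type.
Hypotheses (q1 : 1 < q) (usol : ancient_solution q u).
Variables (rho M Lam : R) (k : nat) (p0 : P) (j : 'I_n.+1) (sg : R).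
Hypotheses (sgE : `|sg| = 1) (rho0 : 0 < rho) (M0 : 0 < M).
Hypotheses (p0x : 4 * rho <= xlast p0.1) (p0t : p0.2 < 0).
Hypothesis uM : forall p : P, (forall i, `|p.1 0 i - p0.1 0 i| <= 3 * rho) ->
  p.2 <= p0.2 -> `|u p| <= M.
Hypotheses (k0 : (0 < k)%N) (kq : 1 <= k%:R * (q - 1)) (Lam1 : 1 <= Lam).
Hypothesis Lamq : 4 * k%:R * q <= Lam * (q - 1).

(** The derivatives of the power -k of the cutoff produce these terms: the time derivative gives k,
    the second derivative of the cutoff summed over the n+1 directions gives 2k(n+1), and the
    squares of its first derivatives give 4k(k+1). *)
Let C1 : R := k%:R + 2 * k%:R * n.+1%:R + 4 * k%:R * (k%:R + 1).

Hypothesis big :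
  C1 + 4 * k%:R < (q - 1) / (q + 1) * rho * (2 * M * Lam / rho) `^ (q - 1).

Let V := logu u (3 * M).
(** The radius 3 rho has room for a point of the box of radius rho, its shift by at most rho, and a
    variation below rho; by 4 rho <= x_n it stays inside the half-space. *)
Let near (p : P) := (forall i, `|p.1 0 i - p0.1 0 i| <= 3 * rho) /\ p.2 <= p0.2.

Let nearQ p : near p -> Qset p.
Proof.
move: (rho0) (p0x) (p0t) => r0 px pt [/(_ ord_max)/ler_normlP[a1 a2] a3].
by split; [rewrite /xlast in px *; lra|exact: le_lt_trans pt].
Qed.

Let near_bound p : near p -> 2 * M <= 3 * M - u p <= 4 * M.
Proof.
move: (M0) => M00 [p1 p2]; have /ler_normlP[a1 a2] := uM p1 p2.
by apply/andP; split; lra.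
Qed.

Let near_lt p : near p -> u p < 3 * M.
Proof. by move: (M0) => M00 /near_bound/andP[+ _]; lra. Qed.

Definition cutoff (p : P) : R :=
  1 - (\sum_i (p.1 0 i - p0.1 0 i) ^+ 2) / rho ^+ 2 - (p0.2 - p.2) / rho ^+ 2.

Lemma cutoff_line_ex p i r : cutoff (p + r *: ex R i) =
  cutoff p - (2 * (p.1 0 i - p0.1 0 i) * r + r ^+ 2) / rho ^+ 2.
Proof.
rewrite /cutoff time_line_ex; under eq_bigr => l _ do rewrite coord_line_ex.
rewrite (bigD1 i) //= [in RHS](bigD1 i) //= eqxx mulr1.
rewrite (eq_bigr (fun l => (p.1 0 l - p0.1 0 l) ^+ 2)); last first.
  by move=> l /negPf ->; rewrite mulr0 addr0.
by field; rewrite gt_eqF.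
Qed.

Lemma cutoff_line_et p r : cutoff (p + r *: et R n) = cutoff p + r / rho ^+ 2.
Proof. by rewrite /cutoff time_line_et space_line_et; field; rewrite gt_eqF. Qed.

Lemma continuous_cutoff : continuous cutoff.
Proof.
move=> p; apply: cvgB; last first.
  by apply: cvgM; [apply: cvgB; [exact: cvg_cst|exact: continuous_time]|exact: cvg_cst].
apply: cvgB; first exact: cvg_cst.
apply: cvgM; last exact: cvg_cst.
apply: cvg_big => [|i _]; first exact: add_continuous.
apply: (@cvg_comp _ _ _ (fun p : P => p.1 0 i - p0.1 0 i)
  (fun y : R => y ^+ 2) _ (nbhs (p.1 0 i - p0.1 0 i))).
  by apply: cvgB; [exact: continuous_coord|exact: cvg_cst].
exact: exprn_continuous.
Qed.

Lemma cutoff_gt0 p : p.2 <= p0.2 -> 0 < cutoff p ->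
  [/\ cutoff p <= 1, \sum_i (p.1 0 i - p0.1 0 i) ^+ 2 < rho ^+ 2 &
      p0.2 - p.2 < rho ^+ 2].
Proof.
move=> pt c0; have r2 : 0 < rho ^+ 2 by rewrite exprn_gt0.
have s0 : 0 <= \sum_i (p.1 0 i - p0.1 0 i) ^+ 2.
  by apply: sumr_ge0 => i _; exact: sqr_ge0.
have a0 : 0 <= (\sum_i (p.1 0 i - p0.1 0 i) ^+ 2) / rho ^+ 2.
  by apply: divr_ge0 => //; exact: ltW.
have b0 : 0 <= (p0.2 - p.2) / rho ^+ 2.
  by apply: divr_ge0; [rewrite subr_ge0|exact: ltW].
move: c0; rewrite /cutoff; set S := \sum_i _ in s0 a0 *.
move: a0 b0; set X := S / _; set Y := (_ - _) / _ => a0 b0 c0; split.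
- by lra.
- by rewrite -[ltRHS]mul1r -ltr_pdivrMr // -/X; lra.
- by rewrite -[ltRHS]mul1r -ltr_pdivrMr // -/Y; lra.
Qed.

Let c : R := Lam / rho.
Let shift (s : R) : P := (s * sg) *: ex R j.
(** The cutoff is 1 at [p0], so [w <= 0] gives there a slope bound [c] for V in the direction [sg]
    e_j. Truncation at 0 makes [w] nonpositive where the cutoff is; a positive maximum lies where
    the cutoff is positive and smooth. *)
Let w (p : P) (s : R) : R :=
  (Num.max (cutoff p) 0) ^+ k * (V (p + shift s) - V p) - c * s.

Let lo (i : 'I_n.+1) := p0.1 0 i - rho.
Let hi (i : 'I_n.+1) := p0.1 0 i + rho.
Let B := box lo hi (p0.2 - rho ^+ 2) p0.2.

Let near_shift p s i r : B p -> 0 <= s <= rho -> `|r| < rho ->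
  near (p + shift s + r *: ex R i) /\ near (p + r *: ex R i).
Proof.
move=> [px /andP[_ pt]] /andP[s0 s1] rr.
have sb l : `|s * sg * (l == j)%:R| <= rho.
  rewrite !normrM sgE mulr1 (ger0_norm s0) normr_nat.
  by case: (l == j); rewrite ?mulr1 ?mulr0 //; exact: ltW.
have rb l : `|r * (l == i)%:R| <= rho.
  by rewrite normrM normr_nat; case: (l == i); rewrite ?mulr1 ?mulr0; exact: ltW.
have pb l : `|p.1 0 l - p0.1 0 l| <= rho.
  by have /andP[] := px l; rewrite /lo /hi ler_norml => *; apply/andP; split; lra.
split; split; rewrite ?time_line_ex // => l; rewrite !coord_line_ex.
  rewrite addrAC [_ + _ - _]addrAC.
  apply: (le_trans (ler_normD _ _)); have := ler_normD (p.1 0 l - p0.1 0 l) (s * sg * (l == j)%:R).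
  have := sb l; have := rb l; have := pb l; lra.
rewrite addrAC; apply: (le_trans (ler_normD _ _)).
have := rb l; have := pb l; have := rho0; lra.
Qed.

Let near_box p s : B p -> 0 <= s <= rho -> near (p + shift s) /\ near p.
Proof.
move=> pB sr; have := @near_shift p s j 0 pB sr; rewrite normr0 scale0r !addr0.
exact.
Qed.

Let w_continuous : {within B `*` `[0, rho]%classic,
  continuous (fun z => w z.1 z.2)}.
Proof.
have Bz z : (B `*` `[0, rho]%classic) z -> B z.1 /\ 0 <= z.2 <= rho.
  by move=> [z1]; rewrite /= in_itv.
have near0 : forall p, near p -> Qbar p /\ 0 < 3 * M - u p.
  move=> p np; split; last by rewrite subr_gt0; exact: near_lt.
  by have [? ?] := nearQ np; split; exact: ltW.
have cf : continuous (@fst P R) by move=> z; exact: cvg_fst.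
have cs : continuous (@snd P R) by move=> z; exact: cvg_snd.
apply: within_continuousB; last first.
  by apply: within_continuousZ; exact: continuous_subspaceT.
apply: within_continuousM.
  apply: continuous_subspaceT => z.
  apply: (@cvg_comp _ _ _ (fun z : P * R => Num.max (cutoff z.1) 0)
    (fun y : R => y ^+ k) _ (nbhs (Num.max (cutoff z.1) 0))); last exact: exprn_continuous.
  apply: (@continuous_max R _ (fun z : P * R => cutoff z.1) (fun=> 0)).
    apply: (@cvg_comp _ _ _ fst cutoff _ _ _ (cf z)); exact: continuous_cutoff.
  exact: cvg_cst.
apply: within_continuousB; apply: within_continuous_ln.
- by move=> z /Bz[z1 z2]; have [/near0[]] := near_box z1 z2.
- apply: within_continuousB; first exact: within_continuous_cst.
  apply: (within_continuous_shift usol); last first.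
    by move=> z /Bz[z1 z2]; have [/near0[]] := near_box z1 z2.
  move=> z; apply: cvgD; first exact: cf.
  by apply: cvgZ; [apply: cvgM; [exact: cs|exact: cvg_cst]|exact: cvg_cst].
- by move=> z /Bz[z1 z2]; have [_ /near0[]] := near_box z1 z2.
- apply: within_continuousB; first exact: within_continuous_cst.
  apply: (within_continuous_shift usol) => //.
  by move=> z /Bz[z1 z2]; have [_ /near0[]] := near_box z1 z2.
Qed.

Let w_pos p s : B p -> 0 <= s <= rho -> 0 < w p s ->
  [/\ 0 < s, 0 < cutoff p & 0 < V (p + shift s) - V p].
Proof.
move=> pB /andP[s0 s1] wp.
have c0 : 0 < c by rewrite divr_gt0 // (lt_le_trans ltr01).
have wp' : 0 < Num.max (cutoff p) 0 ^+ k * (V (p + shift s) - V p).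
  by apply: lt_le_trans wp _; rewrite /w gerBl mulr_ge0 // ltW.
have g0 : 0 < cutoff p.
  rewrite ltNge; apply/negP => g0; move: wp'.
  by rewrite max_r // expr0n eqn0Ngt k0 mul0r ltxx.
have D0 : 0 < V (p + shift s) - V p.
  by move: wp'; rewrite pmulr_rgt0 // exprn_gt0 // max_l // ltW.
split => //; rewrite lt_neqAle s0 andbT; apply/eqP => sE.
by move: D0; rewrite -sE /shift mul0r scale0r addr0 subrr ltxx.
Qed.

Let w_inner p s : B p -> 0 <= s <= rho -> 0 < w p s ->
  (forall p', B p' -> w p' s <= w p s) -> (forall i, lo i < p.1 0 i < hi i) /\ p0.2 - rho ^+ 2 < p.2.
Proof.
move=> pB sr wp _; have [_ g0 _] := w_pos pB sr wp.
have pt : p.2 <= p0.2 by case: pB => _ /andP[].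
have [_ Sr tr] := cutoff_gt0 pt g0; split; last by move: tr; lra.
move=> i; have : (p.1 0 i - p0.1 0 i) ^+ 2 < rho ^+ 2.
  apply: le_lt_trans Sr; rewrite (bigD1 i) //= lerDl.
  by apply: sumr_ge0 => l _; exact: sqr_ge0.
rewrite -[_ ^+ 2]real_normK ?num_real // ltr_pXn2r ?nnegrE ?(ltW rho0) //.
by rewrite ltr_norml /lo /hi => /andP[? ?]; apply/andP; split; lra.
Qed.

Section at_maximum.
Variables (p : P) (s : R).
Hypotheses (pB : B p) (sr : 0 <= s <= rho) (wp : 0 < w p s).
Hypothesis wx : forall i, exists2 e, 0 < e &
  forall r, `|r| < e -> w (p + r *: ex R i) s <= w p s.
Hypothesis wt : exists2 e, 0 < e &
  forall r, - e < r -> r <= 0 -> w (p + r *: et R n) s <= w p s.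
Hypothesis ws : forall s', 0 <= s' <= rho -> w p s' <= w p s.

Let a : P := p + shift s.
Let g := cutoff p.
Let D := V a - V p.
Let y i : R := p.1 0 i - p0.1 0 i.
Let Px i := logu_x u (3 * M) i a.
Let Qx i := logu_x u (3 * M) i p.

Let g0 : 0 < g. Proof. by have [] := w_pos pB sr wp. Qed.
Let D0 : 0 < D. Proof. by have [] := w_pos pB sr wp. Qed.
Let pt : p.2 <= p0.2. Proof. by case: pB => _ /andP[]. Qed.
Let g1 : g <= 1. Proof. by have [] := cutoff_gt0 pt g0. Qed.
Let ysum : \sum_i y i ^+ 2 < rho ^+ 2.
Proof. by have [] := cutoff_gt0 pt g0. Qed.
Let na : near a. Proof. by have [] := near_box pB sr. Qed.
Let np : near p. Proof. by have [] := near_box pB sr. Qed.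

Let ybound i : `|y i| <= rho.
Proof.
have [px _] := pB; have /andP[] := px i; rewrite /lo /hi /y => *.
by rewrite ler_norml; apply/andP; split; lra.
Qed.

(** Dividing by the cutoff power shows that the two-point difference of V is touched from above at
    [p] by the explicit function g^k D cutoff^(-k). The derivative tests then involve no product of
    V with the cutoff. *)
Let w_val p' : 0 < cutoff p' -> w p' s <= w p s ->
  V (p' + shift s) - V p' <= g ^+ k * D * (cutoff p')^-1 ^+ k.
Proof.
move=> g'0; rewrite /w (max_l (ltW g'0)) (max_l (ltW g0)) lerD2r => h.
by rewrite exprVn ler_pdivlMr ?exprn_gt0 // mulrC.
Qed.

Let DE : V (p + shift s) - V p = g ^+ k * D * g^-1 ^+ k.
Proof. by rewrite mulrAC exprVn mulfV ?mul1r // expf_neq0 // gt_eqF. Qed.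

Let gk1 : g ^+ k * D * g^-1 ^+ k.+1 = D / g.
Proof.
by rewrite exprS mulrCA -DE mulrC.
Qed.

Let gk2 : g ^+ k * D * g^-1 ^+ k.+2 = D / g ^+ 2.
Proof. by rewrite exprSr mulrA gk1 -mulrA -invfM. Qed.

Lemma maximum_space i :
  Px i = Qx i + D * (2 * k%:R / (rho ^+ 2 * g)) * y i /\
  logu_xx u (3 * M) i a - logu_xx u (3 * M) i p <=
    D * (2 * k%:R / (rho ^+ 2 * g) +
         4 * k%:R * (k%:R + 1) / (rho ^+ 4 * g ^+ 2) * y i ^+ 2).
Proof.
have [e e0 we] := wx i.
pose gr (r : R) := g - (2 * y i * r + r ^+ 2) / rho ^+ 2.
pose g' (r : R) := - (2 * y i + 2 * r) / rho ^+ 2.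
pose C := g ^+ k * D.
pose f (r : R) := V (a + r *: ex R i) - V (p + r *: ex R i) - C * (gr r)^-1 ^+ k.
pose f1 (r : R) := logu_x u (3 * M) i (a + r *: ex R i) -
  logu_x u (3 * M) i (p + r *: ex R i) - C * (- k%:R * g' r * (gr r)^-1 ^+ k.+1).
have grE r : cutoff (p + r *: ex R i) = gr r by exact: cutoff_line_ex.
have gr00 : gr 0 = g by rewrite /gr; field; rewrite gt_eqF.
have dgr (r : R) : is_derive r 1 gr (g' r).
  have h1 := is_derive1Z (is_derive_id r (1 : R)) (2 * y i).
  have h2 := is_derive1X (is_derive_id r (1 : R)) 2.
  have h := is_derive1B (is_derive_cst g r 1) (is_derive1M (is_derive1D h1 h2)
    (is_derive_cst (rho ^+ 2)^-1 r 1)).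
  by apply: (is_derive_eq h); rewrite /g' /= expr1 !mulr1 mulr0 addr0 sub0r mulNr.
have dg' : is_derive (0 : R) 1 g' (- 2 / rho ^+ 2).
  have h := is_derive1M (is_derive1Z (is_derive1D (is_derive_cst (2 * y i) (0 : R) 1)
    (is_derive1Z (is_derive_id (0 : R) 1) 2)) (-1)) (is_derive_cst (rho ^+ 2)^-1 (0 : R) 1).
  have E : g' = fun r => -1 * (2 * y i + 2 * r) * (rho ^+ 2)^-1.
    by apply/funext => r; rewrite /g' mulN1r.
  by rewrite E; apply: (is_derive_eq h); rewrite /= mulr0 addr0 add0r mulr1 mulN1r.
(* The bound g rho / 3 keeps the cutoff positive along the segment, since |2 y_i r + r^2| <= 3 rho
   |r| < g rho^2. *)
pose e1 := Num.min e (Num.min rho (g * rho / 3)).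
have e10 : 0 < e1 by rewrite !lt_min e0 rho0 /= divr_gt0 // mulr_gt0.
have gr0 r : `|r| < e1 -> 0 < gr r.
  rewrite !lt_min => /and3P[_ r1 r2].
  have : (2 * y i * r + r ^+ 2) < g * rho ^+ 2.
    have h : `|r| * (3 * rho) < g * rho ^+ 2.
      have -> : g * rho ^+ 2 = (g * rho / 3) * (3 * rho) by field.
      by rewrite ltr_pM2r // mulr_gt0.
    apply: le_lt_trans h; apply: (le_trans (ler_norm _)).
    apply: (le_trans (ler_normD _ _)).
    rewrite normrX !normrM (gtr0_norm (ltr0Sn _ 1)) expr2.
    have h1 : `|y i| * `|r| <= rho * `|r| by rewrite ler_wpM2r.
    have h2 : `|r| * `|r| <= rho * `|r| by rewrite ler_wpM2r // ltW.
    lra.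
  by rewrite -ltr_pdivrMr ?exprn_gt0 // /gr subr_gt0.
have [||||f10 f2] := @max_second_derivative _ f f1
    (logu_xx u (3 * M) i a - logu_xx u (3 * M) i p -
     C * ((- k%:R * (- 2 / rho ^+ 2)) * (gr 0)^-1 ^+ k.+1 +
          (- k%:R * g' 0) * (- k.+1%:R * g' 0 * (gr 0)^-1 ^+ k.+2))) e1.
- exact: e10.
- move=> r re; have := gr0 r re; move: re; rewrite lt_min => /andP[re _] g'0.
  have : f 0 = 0 by rewrite /f !scale0r !addr0 gr00 -DE subrr.
  move=> ->; rewrite /f subr_le0 -grE.
  rewrite (_ : a + r *: ex R i = p + r *: ex R i + shift s); last by rewrite /a addrAC.
  by apply: w_val; [rewrite grE|exact: we].
- move=> r re; have g'0 := gr0 r re; move: re; rewrite !lt_min => /and3P[_ re _].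
  have [n1 n2] := near_shift i pB sr re.
  have d1 := is_derive_logu_ex usol (nearQ n1) (near_lt n1).
  have d2 := is_derive_logu_ex usol (nearQ n2) (near_lt n2).
  have gn0 : gr r != 0 by rewrite gt_eqF.
  exact: (is_derive1B (is_derive1B d1 d2) (is_derive1Z (is_derive1VX k (dgr r) gn0) C)).
- have d1 := is_derive_logu_x usol i (nearQ na) (near_lt na).
  have d2 := is_derive_logu_x usol i (nearQ np) (near_lt np).
  have gn0 : gr 0 != 0 by rewrite gr00 gt_eqF.
  exact: (is_derive1B (is_derive1B d1 d2) (is_derive1Z (is_derive1M
    (is_derive1Z dg' (- k%:R)) (is_derive1VX k.+1 (dgr 0) gn0)) C)).
have rn0 : rho != 0 by rewrite gt_eqF.
have gn0 : g != 0 by rewrite gt_eqF.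
split.
  move: f10; rewrite /f1 !scale0r !addr0 gr00 -/(Px i) -/(Qx i).
  have -> : C * (- k%:R * g' 0 * g^-1 ^+ k.+1) = - k%:R * g' 0 * (C * g^-1 ^+ k.+1) by ring.
  rewrite gk1 => /subr0_eq PQ; rewrite -[LHS](subrK (Qx i)) PQ addrC.
  by congr (_ + _); rewrite /g'; field; apply/andP.
rewrite -subr_le0; apply: le_trans f2; rewrite gr00.
rewrite le_eqVlt; apply/orP; left; apply/eqP; congr (_ - _).
have -> : C * (- k%:R * (- 2 / rho ^+ 2) * g^-1 ^+ k.+1 +
    - k%:R * g' 0 * (- k.+1%:R * g' 0 * g^-1 ^+ k.+2)) =
  - k%:R * (- 2 / rho ^+ 2) * (C * g^-1 ^+ k.+1) +
    k%:R * k.+1%:R * g' 0 ^+ 2 * (C * g^-1 ^+ k.+2) by ring.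
rewrite gk1 gk2 /g' -[k.+1]addn1 natrD; field; apply/andP; split=> //.
Qed.

Lemma maximum_time :
  - (D * (k%:R / (rho ^+ 2 * g))) <= logu_t u (3 * M) a - logu_t u (3 * M) p.
Proof.
have [e e0 we] := wt.
have r20 : 0 < rho ^+ 2 by rewrite exprn_gt0.
pose gr (r : R) := g + r / rho ^+ 2.
pose C := g ^+ k * D.
have gr00 : gr 0 = g by rewrite /gr mul0r addr0.
have gn0 : gr 0 != 0 by rewrite gr00 gt_eqF.
have dgr : is_derive (0 : R) 1 gr (rho ^+ 2)^-1.
  have h := is_derive1D (is_derive_cst g (0 : R) 1)
    (is_derive1M (is_derive_id (0 : R) 1) (is_derive_cst (rho ^+ 2)^-1 (0 : R) 1)).
  by apply: (is_derive_eq h); rewrite /= mulr0 addr0 add0r mul1r.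
have d1 := is_derive_logu_et usol (nearQ na) (near_lt na).
have d2 := is_derive_logu_et usol (nearQ np) (near_lt np).
pose f (r : R) := V (a + r *: et R n) - V (p + r *: et R n) - C * (gr r)^-1 ^+ k.
have d : is_derive (0 : R) 1 f _ :=
  is_derive1B (is_derive1B d1 d2) (is_derive1Z (is_derive1VX k dgr gn0) C).
have e10 : 0 < Num.min e (g * rho ^+ 2) by rewrite lt_min e0 mulr_gt0.
have := left_max_derivative e10 _ d.
have -> : C * (- k%:R * (rho ^+ 2)^-1 * (gr 0)^-1 ^+ k.+1) =
    - (k%:R / rho ^+ 2 * (C * g^-1 ^+ k.+1)) by rewrite gr00; ring.
rewrite gk1 => h; rewrite -subr_ge0.
have -> : logu_t u (3 * M) a - logu_t u (3 * M) p - - (D * (k%:R / (rho ^+ 2 * g))) =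
    logu_t u (3 * M) a - logu_t u (3 * M) p - - (k%:R / rho ^+ 2 * (D / g)).
  by field; rewrite !gt_eqF.
apply: h => r r1 r0.
have [r2 r3] : - r < e /\ - r < g * rho ^+ 2.
  by move: r1; rewrite ltrNl lt_min => /andP[].
have g'0 : 0 < gr r.
  by rewrite /gr -[g](@mulfK _ (rho ^+ 2)) ?gt_eqF // -mulrDl divr_gt0 //; lra.
have : f 0 = 0 by rewrite /f !scale0r !addr0 gr00 -DE subrr.
move=> ->; rewrite /f subr_le0 /gr -cutoff_line_et.
rewrite (_ : a + r *: et R n = p + r *: et R n + shift s); last by rewrite /a addrAC.
by apply: w_val; [rewrite cutoff_line_et|apply: we => //; lra].
Qed.

(** Decreasing the separation [s] moves only the point [a]. Maximality from the left says that g^k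
    times the slope of V at [a] in the direction [sg] e_j is at least c = Lam / rho. *)
Lemma maximum_gradient : Lam / (rho * g ^+ k) <= enorm Px.
Proof.
have [s0 _ _] := w_pos pB sr wp.
have gk0 : 0 < g ^+ k by rewrite exprn_gt0.
have a0 : a + 0 *: ex R j = a by rewrite scale0r addr0.
have d0 : is_derive (sg * 0) 1 (fun r => V (a + r *: ex R j)) (Px j).
  have := @is_derive_logu_ex _ _ _ _ (3 * M) usol a 0 j; rewrite a0 mulr0.
  by apply; [exact: nearQ|exact: near_lt].
have d1 := is_derive1_comp d0 (is_derive1Z (is_derive_id (0 : R) 1) sg).
pose f (r : R) := g ^+ k * (V (a + (sg * r) *: ex R j) - V p) - c * (s + r).
have d : is_derive (0 : R) 1 f _ :=
  is_derive1B (is_derive1Z (is_derive1B d1 (is_derive_cst (V p) (0 : R) 1)) (g ^+ k))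
  (is_derive1Z (is_derive1D (is_derive_cst s (0 : R) 1) (is_derive_id (0 : R) 1)) c).
have := left_max_derivative s0 _ d.
rewrite subr0 mulr1 add0r mulr1 => h.
have {}h : 0 <= g ^+ k * (Px j * sg) - c.
  apply: h => r r1 r2.
  have wE r' : w p (s + r') = f r'.
    rewrite /w /f (max_l (ltW g0)) /a /shift -addrA -scalerDl.
    by rewrite (_ : (s + r') * sg = s * sg + sg * r'); last by ring.
  rewrite -wE -[X in f X]/0 -wE addr0; apply: ws.
  by have /andP[? ?] := sr; apply/andP; split; lra.
have : c <= g ^+ k * enorm Px.
  apply: (@le_trans _ _ (g ^+ k * (Px j * sg))); first by rewrite -subr_ge0.
  rewrite ler_pM2l //; apply: (le_trans (ler_norm _)).
  by rewrite normrM sgE mulr1; exact: enorm_coord.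
by move=> h1; rewrite invfM mulrA ler_pdivrMr // [leRHS]mulrC.
Qed.

(** Subtract the equations for V at [a] and [p]. The time and space tests bound the difference of
    the left sides below by - D C1 / (rho^2 g^2), whereas [bernstein_inequality] puts the difference
    of the right sides strictly below that. *)
Lemma no_maximum : False.
Proof.
have rn0 : rho != 0 by rewrite gt_eqF.
have gn0 : g != 0 by rewrite gt_eqF.
have /andP[va1 va2] := near_bound na; have /andP[vb1 vb2] := near_bound np.
have M20 : 0 < 2 * M by rewrite mulr_gt0.
have va0 := lt_le_trans M20 va1; have vb0 := lt_le_trans M20 vb1.
(* Both values of 3M - u lie between 2M and 4M, so their ratio is at most 2 and D <= ln 2 <= 1. *)
have D1 : D <= 1.
  rewrite /D /V /logu lerBlDl.
  have : 3 * M - u a <= (1 + 1) * (3 * M - u p).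
    by apply: (le_trans va2); move: vb1; lra.
  rewrite -ler_ln ?posrE ?mulr_gt0 // lnM ?posrE // => /le_trans; apply.
  by rewrite addrC lerD2l le_ln1Dx // ltrN10.
have vbE : 3 * M - u p = (3 * M - u a) * expR (- D).
  rewrite -{1}(lnK vb0) -{1}(lnK va0) -expRD; congr expR.
  by rewrite /D /V /logu; ring.
have yn : enorm y <= rho.
  rewrite -(@ler_pXn2r _ 2) ?nnegrE ?enorm_ge0 ?(ltW rho0) // enorm_sqr.
  exact: ltW.
have d0 : 0 <= D * (2 * k%:R / (rho ^+ 2 * g)).
  by apply: mulr_ge0; [exact: ltW|apply: divr_ge0; rewrite ?mulr_ge0 ?ler0n ?exprn_ge0 ?(ltW rho0) ?(ltW g0)].
have dE : D * (2 * k%:R / (rho ^+ 2 * g)) * rho = D * (2 * k%:R / (rho * g)).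
  by field; apply/andP.
have PQ : enorm Px <= enorm Qx + D * (2 * k%:R / (rho * g)).
  rewrite (eq_enorm (fun i => (maximum_space i).1)).
  by apply: (le_trans (enormD _ _)); rewrite lerD2l enormZ // -dE ler_wpM2l.
have QP : enorm Qx <= enorm Px + D * (2 * k%:R / (rho * g)).
  rewrite (@eq_enorm _ _ Qx (fun i => Px i + D * (2 * k%:R / (rho ^+ 2 * g)) * - y i)).
    apply: (le_trans (enormD _ _)); rewrite lerD2l enormZ // -dE ler_wpM2l //.
    suff -> : enorm (fun i => - y i) = enorm y by [].
    by rewrite /enorm; congr Num.sqrt; apply: eq_bigr => i _; rewrite sqrrN.
  by move=> i; rewrite (maximum_space i).1 mulrN addrK.
have q0 : 0 < q by exact: lt_trans ltr01 q1.
have lapE : \sum_i logu_xx u (3 * M) i a - \sum_i logu_xx u (3 * M) i p <=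
    D * ((2 * k%:R * n.+1%:R + 4 * k%:R * (k%:R + 1)) / (rho ^+ 2 * g ^+ 2)).
  rewrite -sumrB; apply: (le_trans (ler_sum _ (fun i _ => (maximum_space i).2))).
  rewrite -mulr_sumr ler_pM2l // big_split /= sumr_const card_ord -mulr_sumr.
  rewrite [leRHS]mulrDl; apply: lerD; last first.
    have -> : 4 * k%:R * (k%:R + 1) / (rho ^+ 2 * g ^+ 2) =
        4 * k%:R * (k%:R + 1) / (rho ^+ 4 * g ^+ 2) * rho ^+ 2.
      by field; apply/andP.
    apply: ler_wpM2l; last exact: ltW.
    apply: divr_ge0; first by rewrite !mulr_ge0 // addr_ge0.
    by apply: mulr_ge0; apply: exprn_ge0; exact: ltW.
  rewrite -[_ *+ n.+1]mulr_natr [leLHS]mulrAC; apply: ler_wpM2l; first by rewrite !mulr_ge0.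
  rewrite lef_pV2 ?posrE ?mulr_gt0 ?exprn_gt0 // ler_pM2l ?exprn_gt0 //.
  by rewrite expr2 ler_piMr // ltW.
have timeE : - (D * (k%:R / (rho ^+ 2 * g ^+ 2))) <=
    logu_t u (3 * M) a - logu_t u (3 * M) p.
  apply: (le_trans _ maximum_time); rewrite lerN2 ler_pM2l //.
  apply: ler_wpM2l; first exact: ler0n.
  rewrite lef_pV2 ?posrE ?mulr_gt0 ?exprn_gt0 // ler_pM2l ?exprn_gt0 //.
  by rewrite expr2 ler_piMr // ltW.
have C10 : 0 <= C1 by rewrite /C1 !addr_ge0 // !mulr_ge0 ?addr_ge0 ?ler0n.
have D01 : 0 < D <= 1 by rewrite D0.
have g01 : 0 < g <= 1 by rewrite g0.
have := bernstein_inequality q1 kq k0 Lam1 Lamq D01 g01 rho0 C10 M0 (enorm_ge0 _)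
  maximum_gradient QP PQ va1 vbE big.
have e1 := logu_pde usol q0 (nearQ na) (near_lt na).
have e2 := logu_pde usol q0 (nearQ np) (near_lt np).
apply/negP; rewrite -leNgt.
have -> : D * (C1 / (rho ^+ 2 * g ^+ 2)) = D * (k%:R / (rho ^+ 2 * g ^+ 2)) +
    D * ((2 * k%:R * n.+1%:R + 4 * k%:R * (k%:R + 1)) / (rho ^+ 2 * g ^+ 2)).
  by rewrite /C1; field; apply/andP.
move: e1 e2 lapE timeE; rewrite -/Px -/Qx.
set X := D * (k%:R / _); set Y := D * (_ / _); set S1 := \sum_i _; set S2 := \sum_i _.
lra.
Qed.

End at_maximum.

Lemma two_point_bound s : 0 <= s <= rho ->
  logu u (3 * M) (p0 + (s * sg) *: ex R j) - logu u (3 * M) p0 <= Lam / rho * s.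
Proof.
move=> sr; rewrite leNgt; apply/negP => h.
have cp0 : cutoff p0 = 1.
  by rewrite /cutoff subrr mul0r subr0 big1 ?mul0r ?subr0 // => i _; rewrite subrr expr0n.
have p0B : B p0.
  split; first by move=> i; rewrite /lo /hi; have := rho0 => r0; apply/andP; split; lra.
  by rewrite lexx andbT gerBl sqr_ge0.
have wp0 : 0 < w p0 s by rewrite /w cp0 max_l ?ler01 // expr1n mul1r subr_gt0.
have [p [s' [pB s'r wp ws [wx wt]]]] := box_max w_continuous p0B sr wp0 w_inner.
exact: no_maximum pB s'r wp wx wt ws.
Qed.

End two_point.

(** * Invariance under shifts *)

Section half_space.
Variables (R : realType) (n : nat) (q : R) (u : 'rV[R]_n.+1 * R -> R).
Notation P := ('rV[R]_n.+1 * R)%type.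
Hypotheses (q1 : 1 < q) (usol : ancient_solution q u).
Hypothesis sublinear : forall eps : R, 0 < eps -> forall delta : R, 0 < delta ->
  exists R0 : R, forall Rr : R, R0 <= Rr ->
    forall (x : 'rV[R]_n.+1) (t : R),
      0 < xlast x -> xlast x < Rr -> t <= - eps -> `|u (x, t)| <= delta * Rr.

Lemma strip_bound (eps L : R) : 0 < eps ->
  exists M : R, forall p : P, 0 <= xlast p.1 <= L -> p.2 <= - eps -> `|u p| <= M.
Proof.
move=> eps0; have [R0 uR] := sublinear eps0 ltr01.
pose Rr := Num.max (Num.max R0 (L + 1)) 0; exists Rr => -[x t] /= /andP[].
have Rr0 : 0 <= Rr by rewrite le_max lexx orbT.
rewrite le_eqVlt => /predU1P[x0 _|x0 xL] te.
  by rewrite (solution_bottom usol) ?normr0 //=; lra.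
rewrite -[Rr]mul1r; apply: uR => //; first by rewrite !le_max lexx.
have xL1 : xlast x < L + 1 by lra.
by rewrite !lt_max xL1 orbT.
Qed.

(** The two-point bound is applied at scale rho = x_n / 8. There M is a small multiple of rho, and
    the resulting constant 4 M Lam / rho for u no longer depends on rho. *)
Lemma one_sided_lipschitz (eps eta : R) : 0 < eps -> 0 < eta ->
  exists2 R1, 0 < R1 & forall (p : P) j r, R1 <= xlast p.1 -> p.2 <= - eps ->
    `|r| <= xlast p.1 / 8 -> u p - u (p + r *: ex R j) <= eta * `|r|.
Proof.
move=> eps0 eta0; have q10 : 0 < q - 1 by rewrite subr_gt0.
have q0 : 0 < q by exact: lt_trans ltr01 q1.
have iq0 : 0 < (q - 1)^-1 by rewrite invr_gt0.
pose k := Num.bound (q - 1)^-1.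
have kb : (q - 1)^-1 < k%:R by exact: archi_boundP (ltW iq0).
have k0 : (0 < k)%N by rewrite -(ltr_nat R); exact: lt_trans kb.
have kq : 1 <= k%:R * (q - 1) by rewrite -ler_pdivrMr // mul1r ltW.
pose Lam := 1 + 4 * k%:R * q / (q - 1).
have Lam1 : 1 <= Lam.
  by rewrite /Lam lerDl; apply: divr_ge0; rewrite ?(ltW q10) // !mulr_ge0 // ltW.
have Lam0 : 0 < Lam by exact: lt_le_trans Lam1.
have Lamq : 4 * k%:R * q <= Lam * (q - 1).
  by rewrite /Lam [leRHS]mulrDl mul1r divfK ?gt_eqF // lerDr ltW.
(* Chosen so that 4 M Lam / rho = 64 delta Lam = eta once M = 16 delta rho. *)
pose delta := eta / (64 * Lam).
have delta0 : 0 < delta by rewrite divr_gt0 // mulr_gt0.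
pose C : R := k%:R + 2 * k%:R * n.+1%:R + 4 * k%:R * (k%:R + 1) + 4 * k%:R.
have C0 : 0 <= C by rewrite /C !addr_ge0 // !mulr_ge0 // addr_ge0.
(* Since M / rho is fixed, the largeness condition of the two-point bound reads C < Y rho; it holds
   as soon as x_n = 8 rho is large, whence the last entry of [R1]. *)
pose Y := (q - 1) / (q + 1) * (32 * delta * Lam) `^ (q - 1).
have Y0 : 0 < Y.
  apply: mulr_gt0; first by rewrite divr_gt0 // addr_gt0.
  by apply: powR_gt0; apply: mulr_gt0 => //; apply: mulr_gt0.
have [R0 uR] := sublinear eps0 delta0.
pose R1 := Num.max 1 (Num.max R0 (8 * (C / Y + 1))).
exists R1; first by rewrite lt_max ltr01.
move=> p j r; rewrite !ge_max => /and3P[px1 px2 px3] pt rr.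
pose rho := xlast p.1 / 8.
have rhoE : xlast p.1 = 8 * rho by rewrite /rho; field.
rewrite -/rho in rr; rewrite rhoE in px1 px2 px3.
have rho0 : 0 < rho by lra.
(* The neighbourhood of radius 3 rho has 5 rho <= x_n <= 11 rho, so the growth hypothesis with [Rr]
   = 16 rho bounds u there. *)
pose M := delta * (16 * rho).
have M0 : 0 < M by apply: mulr_gt0 => //; apply: mulr_gt0.
pose sg : R := if r < 0 then -1 else 1.
have sgE : `|sg| = 1 by rewrite /sg; case: ifP; rewrite ?normrN normr1.
have rE : `|r| * sg = r.
  rewrite /sg; case: ltP => [r0|r0]; first by rewrite ltr0_norm // mulrN1 opprK.
  by rewrite ger0_norm // mulr1.
have p4 : 4 * rho <= xlast p.1 by rewrite rhoE; lra.
have pt0 : p.2 < 0 by lra.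
have uM (p' : P) : (forall i, `|p'.1 0 i - p.1 0 i| <= 3 * rho) -> p'.2 <= p.2 ->
    `|u p'| <= M.
  case: p' => x t /= /(_ ord_max)/ler_normlP[]; rewrite -/(xlast x) -/(xlast p.1) rhoE.
  by move=> b1 b2 tp; apply: uR; lra.
have big : C < (q - 1) / (q + 1) * rho * (2 * M * Lam / rho) `^ (q - 1).
  have -> : 2 * M * Lam / rho = 32 * delta * Lam by rewrite /M; field; rewrite gt_eqF.
  by rewrite mulrAC -/Y mulrC -ltr_pdivrMr //; lra.
have r0 : 0 <= `|r| <= rho by rewrite normr_ge0.
have := two_point_bound q1 usol j sgE rho0 M0 p4 pt0 uM k0 kq Lam1 Lamq big r0.
rewrite rE /logu; set a := p + _; set va := 3 * M - u a; set vp := 3 * M - u p => h.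
have pn : `|u p| <= M.
  by apply: uM => // i; rewrite subrr normr0; lra.
have an : `|u a| <= M.
  apply: uM => [i|]; last by rewrite time_line_ex.
  rewrite coord_line_ex addrAC subrr add0r normrM normr_nat.
  by case: (i == j); rewrite ?mulr1 ?mulr0; lra.
have [/ler_normlP[p1 p2] /ler_normlP[a1 a2]] := (pn, an).
have va0 : 0 < va by rewrite /va; lra.
have vp0 : 0 < vp by rewrite /vp; lra.
have -> : u p - u a = va - vp by rewrite /va /vp; ring.
have e1 : vp = va * expR (- (ln va - ln vp)).
  by rewrite opprB expRD expRN !lnK ?posrE // mulrCA divff ?mulr1 // gt_eqF.
have e2 := expR_ge1Dx (- (ln va - ln vp)).
(* The inequality 1 - exp(-x) <= x returns from the logarithm to u, at the price of the factor [va]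
   <= 4 M. *)
have e3 : va - vp <= va * (ln va - ln vp).
  by rewrite {1}e1 -{1}[va]mulr1 -mulrBr ler_pM2l //; lra.
apply: (le_trans e3).
have Ls0 : 0 <= Lam / rho * `|r| by rewrite mulr_ge0 // divr_ge0 // ltW.
apply: (@le_trans _ _ (4 * M * (Lam / rho * `|r|))).
  apply: (@le_trans _ _ (va * (Lam / rho * `|r|))); first by rewrite ler_pM2l.
  by apply: ler_wpM2r => //; rewrite /va; lra.
rewrite le_eqVlt; apply/orP; left; apply/eqP.
by rewrite /M /delta; field; rewrite !gt_eqF.
Qed.

(** The reverse inequality is the one-sided one started from the displaced point [a]. The constants
    9 and 2 R1 allow this: x_n(a) is at least 8/9 of x_n(p), so |r| <= x_n(a) / 8 and x_n(a) >=
    R1. *)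
Lemma small_lipschitz (eps eta : R) : 0 < eps -> 0 < eta ->
  exists2 R1, 0 < R1 & forall (p : P) j r, R1 <= xlast p.1 -> p.2 <= - eps ->
    `|r| <= xlast p.1 / 9 -> `|u (p + r *: ex R j) - u p| <= eta * `|r|.
Proof.
move=> eps0 eta0; have [R1 R10 h] := one_sided_lipschitz eps0 eta0.
exists (2 * R1) => [|p j r px pt rr]; first by rewrite mulr_gt0.
have x9 : xlast p.1 / 9 * 9 = xlast p.1 by rewrite divfK.
have x8 : xlast p.1 / 8 * 8 = xlast p.1 by rewrite divfK.
set a := p + r *: ex R j.
have ax : xlast p.1 - `|r| <= xlast a.1.
  rewrite xlast_line_ex lerD2l; case: (j == _); rewrite ?mulr1 ?mulr0 ?oppr_le0 //.
  by rewrite lerNl -normrN ler_norm.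
have pE : p = a + (- r) *: ex R j by rewrite /a -addrA -scalerDl subrr scale0r addr0.
apply/ler_normlP; split.
  rewrite opprB; apply: h => //; lra.
have := h a j (- r); rewrite -pE normrN; apply.
- lra.
- by rewrite time_line_ex.
- have : xlast a.1 / 8 * 8 = xlast a.1 by rewrite divfK.
  lra.
Qed.

(** The comparison is made in a strip reaching beyond both the given point and [R2]; on its upper
    face the hypothesis at infinity supplies the bound [kap], which is arbitrary. *)
Lemma shift_le (h : P) (tau : R) : xlast h.1 = 0 -> tau < 0 -> tau + h.2 < 0 ->
  (forall kap, 0 < kap -> exists R2, forall p : P, R2 <= xlast p.1 ->
     p.2 <= tau -> u (p + h) - u p <= kap) ->
  forall p : P, 0 < xlast p.1 -> p.2 <= tau -> u (p + h) <= u p.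
Proof.
move=> h0 tau0 tauh far p px pt; rewrite -subr_le0; apply/ler_addgt0Pr => kap kap0.
rewrite add0r; have [R2 hR] := far _ kap0.
pose L := Num.max R2 (xlast p.1).
have pL : 0 <= xlast p.1 <= L by rewrite (ltW px) le_max lexx orbT.
have L0 : 0 < L by rewrite lt_max px orbT.
pose eps := Num.min (- tau) (- (tau + h.2)).
have eps0 : 0 < eps by rewrite lt_min !oppr_gt0 tau0.
have [M uM] := @strip_bound eps L eps0.
have epsE : tau <= - eps /\ tau + h.2 <= - eps.
  by split; rewrite lerNr ge_min lexx ?orbT.
apply: (strip_comparison q1 usol h0 tau0 tauh L0 (ltW kap0) (M := M)) pL pt.
- move=> p' p'L p't; split; apply: uM => //; first by apply: le_trans p't _; case: epsE.
    by move: h0; rewrite /xlast /= mxE => ->; rewrite addr0.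
  by rewrite /=; case: epsE; lra.
- by move=> p' p'L p't; apply: hR; rewrite // p'L le_max lexx.
Qed.

Lemma tangential_invariance (p : P) (j : 'I_n.+1) (r : R) : Qset p ->
  j != ord_max -> u (p + r *: ex R j) = u p.
Proof.
move=> pQ jm; have le (p' : P) (r' : R) : Qset p' -> u (p' + r' *: ex R j) <= u p'.
  move=> [p'x p't].
  apply: (@shift_le (r' *: ex R j) p'.2) => //.
  - by rewrite /xlast /= !mxE eq_sym (negPf jm) andbF mulr0.
  - by rewrite /= scaler0 addr0.
  move=> kap kap0.
  have np0 : 0 < - p'.2 by rewrite oppr_gt0.
  (* A Lipschitz constant kap / (|r'| + 1) makes the oscillation over the fixed distance |r'| at
     most kap; adding 1 covers r' = 0. *)
  have e0 : 0 < kap / (`|r'| + 1) by rewrite divr_gt0 // ltr_wpDl.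
  have [R1 R10 lip] := small_lipschitz np0 e0.
  exists (Num.max R1 (9 * `|r'|)) => z; rewrite ge_max => /andP[z1 z2] zt.
  apply: (le_trans (ler_norm _)); apply: (le_trans (lip _ _ _ z1 _ _)).
  - by rewrite opprK.
  - by rewrite ler_pdivlMr // mulrC.
  - by rewrite mulrAC ler_pdivrMr ?ltr_wpDl // ler_pM2l // lerDl.
apply/eqP; rewrite eq_le le //=.
have aQ : Qset (p + r *: ex R j).
  case: pQ => p1 p2; split; last by rewrite time_line_ex.
  by rewrite xlast_line_ex (negPf jm) mulr0 addr0.
have := le _ (- r) aQ.
by rewrite -addrA -scalerDl subrr scale0r addr0.
Qed.

(** * Reduction to the normal variable and invariance in time *)

Lemma dx_tangential (p : P) (j : 'I_n.+1) : Qset p -> j != ord_max ->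
  dx u j p = 0 /\ dx (dx u j) j p = 0.
Proof.
move=> pQ jm.
have dx0 p' : Qset p' -> dx u j p' = 0.
  move=> p'Q; have p0 : p' + 0 *: ex R j = p' by rewrite scale0r addr0.
  have h : is_derive (0 : R) 1 (fun r => u (p' + r *: ex R j)) (dx u j p').
    by rewrite -{2}p0; apply: (is_derive_dx usol); rewrite p0.
  have E : (fun r => u (p' + r *: ex R j)) = cst (u p').
    by apply/funext => r; rewrite tangential_invariance.
  by rewrite E in h; rewrite -(@derive_val _ _ _ _ _ _ _ h) derive_cst.
split; first exact: dx0.
have h := is_derive_dxx usol j pQ.
have E : (fun r => dx u j (p + r *: ex R j)) = cst 0.
  apply/funext => r; apply: dx0; case: pQ => p1 p2; split; last by rewrite time_line_ex.
  by rewrite xlast_line_ex (negPf jm) mulr0 addr0.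
by rewrite E in h; rewrite -(@derive_val _ _ _ _ _ _ _ h) derive_cst.
Qed.

Lemma normal_pde (p : P) : Qset p ->
  dt u p - dx (dx u ord_max) ord_max p = `|dx u ord_max p| `^ q.
Proof.
move=> pQ; have := solution_pde usol pQ.
rewrite /lap (bigD1 ord_max) //= big1 ?addr0 => [->|j jm]; last first.
  by case: (dx_tangential pQ jm).
rewrite /enorm (bigD1 ord_max) //= big1 ?addr0 ?sqrtr_sqr // => j jm.
by case: (dx_tangential pQ jm) => -> _; rewrite expr0n.
Qed.

(** The barrier l + 3 l y^2 + B tau is compared with sgn (u - u(p)) for |y| <= 1. At an interior
    maximum of the difference the normal derivative of u is at most 6 l in size, sgn times the
    second one is at most 6 l, and sgn u_t >= B, against the choice of [B]. Both signs are covered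
    because the nonlinearity enters only through its size. *)
Lemma time_oscillation (l B s sgn : R) (p : P) : `|sgn| = 1 ->
  0 < l -> 6 * l + (6 * l) `^ q < B -> 0 <= s -> 1 < xlast p.1 ->
  p.2 + s < 0 ->
  (forall tau y, 0 <= tau <= s -> `|y| <= 1 ->
     `|u (p + tau *: et R n + y *: ex R ord_max) - u (p + tau *: et R n)| <= l * `|y|) ->
  sgn * (u (p + s *: et R n) - u p) <= l + B * s.
Proof.
move=> sgn1 l0 lB s0 px ps lip.
have B0 : 0 < B by apply: le_lt_trans lB; rewrite addr_ge0 ?powR_ge0 // mulr_ge0 // ltW.
rewrite leNgt; apply/negP => pos.
(* The plane of the normal and time directions through [p] is parametrised with one space
   coordinate, so that [box_max] applies in dimension one. *)
pose pt (z : 'rV[R]_1 * R) : P := p + z.2 *: et R n + z.1 0 0 *: ex R ord_max.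
pose w (z : 'rV[R]_1 * R) (a : R) :=
  sgn * (u (pt z) - u p) - 3 * l * z.1 0 0 ^+ 2 - B * z.2 - l.
pose lo (i : 'I_1) : R := -1; pose hi (i : 'I_1) : R := 1.
have boxE z : box lo hi 0 s z <-> `|z.1 0 0| <= 1 /\ 0 <= z.2 <= s.
  split=> [[/(_ 0) z1 z2]|[z1 z2]]; first by rewrite ler_norml; split; [exact: z1|exact: z2].
  by split => // i; rewrite ord1 /lo /hi -ler_norml.
have ptx z : xlast (pt z).1 = xlast p.1 + z.1 0 0.
  by rewrite /pt xlast_line_ex eqxx mulr1 space_line_et.
have ptt z : (pt z).2 = p.2 + z.2 by rewrite /pt time_line_ex time_line_et.
have ptQ z : box lo hi 0 s z -> Qset (pt z).
  move=> /boxE[/ler_normlP[z1 z1'] /andP[z2 z3]].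
  by split; rewrite ?ptx ?ptt; lra.
have center (z : 'rV[R]_1 * R) : pt (0, z.2) = p + z.2 *: et R n.
  by rewrite /pt /= mxE scale0r addr0.
have boxc z : box lo hi 0 s z -> box lo hi 0 s (0, z.2).
  by move=> /boxE[_ z2]; apply/boxE; rewrite /= mxE normr0.
pose z0 : 'rV[R]_1 * R := (0, s).
have z0B : box lo hi 0 s z0 by apply/boxE; rewrite /= mxE normr0 ler01 s0 lexx.
have wz0 : 0 < w z0 0.
  by rewrite /w (center z0) /= mxE expr0n /= mulr0; move: pos; lra.
have sgn_le (x : R) : sgn * x <= `|x|.
  by apply: (le_trans (ler_norm _)); rewrite normrM sgn1 mul1r.
have inner z a : box lo hi 0 s z -> 0 <= a <= 0 -> 0 < w z a ->
    (forall z', box lo hi 0 s z' -> w z' a <= w z a) ->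
    (forall i, lo i < z.1 0 i < hi i) /\ 0 < z.2.
  move=> zB _ wz zmax; have /boxE[z1 z2] := zB.
  have h := lip z.2 (z.1 0 0) z2 z1; split=> [i|].
    rewrite ord1 /lo /hi -ltr_norml lt_neqAle z1 andbT; apply/eqP => zE.
    (* Going from y = 0 to |y| = 1 at equal time gains at most l from u but loses 3 l to the
       barrier, so no positive maximum lies on a lateral face. *)
    have := zmax _ (boxc _ zB); rewrite /w center /= mxE expr0n /= mulr0.
    have := sgn_le (u (pt z) - u (p + z.2 *: et R n)).
    rewrite -[z.1 0 0 ^+ 2]real_normK ?num_real // zE; rewrite zE in h.
    move: h; rewrite -/(pt z) => h1 h2 h3; nra.
  rewrite lt_neqAle; have /andP[-> _] := z2; rewrite andbT; apply/eqP => zE.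
  move: wz h; rewrite /w /pt -zE !scale0r !addr0 => wz h.
  have := sgn_le (u (p + z.1 0 0 *: ex R ord_max) - u p).
  have : l * `|z.1 0 0| <= l by rewrite ler_piMr // ltW.
  have : 0 <= 3 * l * z.1 0 0 ^+ 2 by rewrite mulr_ge0 ?sqr_ge0 // mulr_ge0 // ltW.
  lra.
have wc : {within box lo hi 0 s `*` `[0 : R, 0]%classic,
    continuous (fun z => w z.1 z.2)}.
  have cf : continuous (@fst ('rV[R]_1 * R)%type R) by move=> z; exact: cvg_fst.
  have c0 : continuous (fun z : 'rV[R]_1 * R * R => z.1.1 0 0).
    move=> z; apply: (@cvg_comp _ _ _ fst (fun z : 'rV[R]_1 * R => z.1 0 0) _ _ _ (cf z)).
    exact: continuous_coord.
  have c1 : continuous (fun z : 'rV[R]_1 * R * R => z.1.2).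
    move=> z; apply: (@cvg_comp _ _ _ fst (fun z : 'rV[R]_1 * R => z.2) _ _ _ (cf z)).
    exact: cvg_snd.
  apply: within_continuousB; last exact: within_continuous_cst.
  apply: within_continuousB; last first.
    by apply: within_continuousZ; exact: continuous_subspaceT.
  apply: within_continuousB.
    apply: within_continuousZ; apply: within_continuousB.
      apply: (within_continuous_shift usol) => [z|z [/ptQ[z1 z2] _]].
        apply: cvgD; last by apply: cvgZ; [exact: c0|exact: cvg_cst].
        by apply: cvgD; [exact: cvg_cst|apply: cvgZ; [exact: c1|exact: cvg_cst]].
      by split; exact: ltW.
    exact: within_continuous_cst.
  by apply: within_continuousZ; apply: within_continuousM; exact: continuous_subspaceT.
have r00 : 0 <= (0 : R) <= 0 by rewrite lexx.
have [z [a [zB _ _ _ [/(_ 0)[e e0 wx] [e' e'0 wt]]]]] := box_max wc z0B r00 wz0 inner.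
have zQ := ptQ _ zB.
pose m : 'I_n.+1 := ord_max.
pose y : R := z.1 0 0.
have /boxE[y1 _] := zB.
have space : sgn * dx u m (pt z) = 6 * l * y /\ sgn * dx (dx u m) m (pt z) <= 6 * l.
  pose f (r : R) := sgn * (u (pt z + r *: ex R m) - u p) -
    (3 * l * (y + r) ^+ 2 + (B * z.2 + l)).
  pose f1 (r : R) := sgn * (dx u m (pt z + r *: ex R m) - 0) -
    (3 * l * (2 * (y + r)) + 0).
  have fE r : w (z + r *: ex R 0) a = f r.
    rewrite /w /f /pt coord_line_ex time_line_ex eqxx mulr1 -/y scalerDl !addrA.
    ring.
  have f0 : w z a = f 0 by rewrite -fE scale0r addr0.
  have dsq (r : R) : is_derive r 1 (fun r => (y + r) ^+ 2) (2 * (y + r)).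
    have h := is_derive1X (is_derive1D (is_derive_cst y r 1) (is_derive_id r (1 : R))) 2.
    by apply: (is_derive_eq h); rewrite /= expr1 add0r mulr1.
  have [||||f10 f2] := @max_second_derivative _ f f1
    (sgn * dx (dx u m) m (pt z) - (3 * l * (2 * 1)))
    (Num.min e (xlast (pt z).1)).
  - by rewrite lt_min e0; case: zQ.
  - by move=> r; rewrite lt_min => /andP[re _]; rewrite -f0 -fE; exact: wx.
  - move=> r; rewrite lt_min => /andP[_ rx].
    have d1 := is_derive_dx usol (Qset_line_ex m zQ rx).
    exact: (is_derive1B (is_derive1Z (is_derive1B d1 (is_derive_cst _ _ _)) sgn)
      (is_derive1D (is_derive1Z (dsq r) (3 * l)) (is_derive_cst _ _ _))).
  - have h := is_derive1B (is_derive1Z (is_derive1B (is_derive_dxx usol m zQ)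
      (is_derive_cst 0 (0 : R) 1)) sgn) (is_derive1D (is_derive1Z (is_derive1Z
      (is_derive1D (is_derive_cst y (0 : R) 1) (is_derive_id (0 : R) 1)) 2) (3 * l))
      (is_derive_cst 0 (0 : R) 1)).
    by apply: (is_derive_eq h); rewrite subr0 add0r addr0.
  move: f10; rewrite /f1 scale0r !addr0 subr0 => /subr0_eq ->.
  by split; [ring|move: f2; lra].
have time : B <= sgn * dt u (pt z).
  pose f (r : R) := sgn * (u (pt z + r *: et R n) - u p) -
    (3 * l * y ^+ 2 + B * (z.2 + r) + l).
  have fE r : w (z + r *: et R 0) a = f r.
    rewrite /w /f /pt space_line_et time_line_et -/y scalerDl -!addrA.
    rewrite [r *: _ + _]addrC; ring.
  have f0 : w z a = f 0 by rewrite -fE scale0r addr0.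
  have h := is_derive1B (is_derive1Z (is_derive1B (is_derive_dt usol zQ)
    (is_derive_cst (u p) (0 : R) 1)) sgn) (is_derive1D (is_derive1D
    (is_derive_cst (3 * l * y ^+ 2) (0 : R) 1) (is_derive1Z (is_derive1D
    (is_derive_cst z.2 (0 : R) 1) (is_derive_id (0 : R) 1)) B)) (is_derive_cst l (0 : R) 1)).
  have {}h : is_derive (0 : R) 1 f (sgn * dt u (pt z) - B).
    by apply: (is_derive_eq h); rewrite subr0 !add0r addr0 mulr1.
  rewrite -subr_ge0; apply: (left_max_derivative e'0 _ h) => r r1 r2.
  by have := wt r r1 r2; rewrite fE f0.
have [sp1 sp2] := space.
have := normal_pde zQ; rewrite -/m.
have -> : `|dx u m (pt z)| = `|6 * l * y| by rewrite -sp1 normrM sgn1 mul1r.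
have gq : `|6 * l * y| `^ q <= (6 * l) `^ q.
  have l60 : 0 <= 6 * l by rewrite mulr_ge0 // ltW.
  apply: ge0_ler_powR; rewrite ?nnegrE //; first exact: ltW (lt_trans ltr01 q1).
  by rewrite normrM ger0_norm // ler_piMr.
move=> pde; have sq := sgn_le (`|6 * l * y| `^ q).
rewrite (ger0_norm (powR_ge0 _ _)) in sq.
have : sgn * dt u (pt z) = sgn * dx (dx u m) m (pt z) + sgn * `|6 * l * y| `^ q.
  by rewrite -pde; ring.
move: time lB sp2 gq sq; lra.
Qed.

Lemma small_time_oscillation (eps s sgn kap : R) : `|sgn| = 1 -> 0 < eps ->
  0 <= s -> 0 < kap -> exists R2, forall p : P, R2 <= xlast p.1 ->
    p.2 + s <= - eps -> sgn * (u (p + s *: et R n) - u p) <= kap.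
Proof.
move=> sgn1 eps0 s0 kap0.
(* For l <= 1 one has l^q <= l, so B = (7 + 6^q) l exceeds 6 l + (6 l)^q, and the bound l + B s
   equals l K, at most kap. *)
pose K := 1 + (7 + 6 `^ q) * s.
have q60 : 0 <= 6 `^ q :> R by exact: powR_ge0.
have K0 : 0 < K by rewrite ltr_pwDl // mulr_ge0 // addr_ge0.
pose l := Num.min 1 (kap / K).
have l0 : 0 < l by rewrite lt_min ltr01 divr_gt0.
have l1 : l <= 1 by rewrite ge_min lexx.
have lK : l * K <= kap by rewrite -ler_pdivlMr // ge_min lexx orbT.
have lq : l `^ q <= l.
  have q10 : 0 <= q - 1 by rewrite subr_ge0 ltW.
  have : l `^ (q - 1) <= 1 `^ (q - 1).
    by apply: ge0_ler_powR; rewrite ?nnegrE // ltW.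
  by rewrite powR1 -(mulr_powRB1 (ltW l0) (lt_trans ltr01 q1)) => ?; rewrite ler_piMr // ltW.
pose B := (7 + 6 `^ q) * l.
have lB : 6 * l + (6 * l) `^ q < B.
  rewrite powRM ?(ltW l0) // /B.
  have : 6 `^ q * l `^ q <= 6 `^ q * l by rewrite ler_wpM2l.
  by move: l0; lra.
have [R1 R10 lip] := small_lipschitz eps0 l0.
exists (Num.max R1 9) => p; rewrite ge_max => /andP[p1 p9] pt.
apply: le_trans lK; have -> : l * K = l + B * s by rewrite /K /B; ring.
apply: (time_oscillation sgn1 l0 lB s0); [lra|lra|].
move=> tau y /andP[t0 ts] yy; apply: lip.
- by rewrite space_line_et.
- by rewrite time_line_et; lra.
- by rewrite space_line_et ler_pdivlMr //; lra.
Qed.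

(** The two inequalities are [shift_le] for the shift by s from [p] and for the shift by -s from the
    later point; the oscillation estimate enters with sign 1 and -1 respectively. *)
Lemma time_invariance (p : P) (s : R) : Qset p -> 0 <= s -> p.2 + s < 0 ->
  u (p + s *: et R n) = u p.
Proof.
move=> [px pt] s0 ps; apply/eqP; rewrite eq_le.
have eps0 : 0 < - (p.2 + s) by rewrite oppr_gt0.
have et0 (r : R) : xlast (r *: et R n).1 = 0 by rewrite /xlast /= scaler0 mxE.
have et2 (r : R) : (r *: et R n).2 = r by rewrite /= /GRing.scale /= mulr1.
have up : u (p + s *: et R n) <= u p.
  apply: (@shift_le (s *: et R n) p.2) => //; first by rewrite et2.
  move=> kap kap0.
  have [R2 h] := small_time_oscillation (normr1 R) eps0 s0 kap0.
  by exists R2 => p' p'x p't; rewrite -[leLHS]mul1r; apply: h => //; rewrite opprK; lra.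
have down : u (p + s *: et R n + (- s) *: et R n) <= u (p + s *: et R n).
  apply: (@shift_le ((- s) *: et R n) (p.2 + s)); rewrite ?et0 ?et2 ?addrK //.
  - move=> kap kap0.
    have sgn1 : `|-1 : R| = 1 by rewrite normrN1.
    have [R2 h] := small_time_oscillation sgn1 eps0 s0 kap0.
    exists R2 => p' p'x p't.
    have := h (p' + (- s) *: et R n).
    rewrite space_line_et time_line_et -[_ + s *: _]addrA -scalerDl addNr scale0r addr0.
    by rewrite mulN1r opprB; apply => //; rewrite opprK; lra.
  - by rewrite space_line_et.
  - by rewrite time_line_et.
move: down; rewrite -addrA -scalerDl subrr scale0r addr0 => down.
by rewrite up down.
Qed.

Lemma tangential_sum (p : P) (c : 'I_n.+1 -> R) : Qset p ->
  u (p + \sum_(i | i != ord_max) c i *: ex R i) = u p.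
Proof.
move: p; elim/big_rec: _ => [p pQ|i v im IH p pQ]; first by rewrite addr0.
rewrite addrA IH; first exact: tangential_invariance.
case: pQ => p1 p2; split; last by rewrite time_line_ex.
by rewrite xlast_line_ex (negPf im) mulr0 addr0.
Qed.

End half_space.

Unset Implicit Arguments.

Theorem theorem2p5 (R : realType) (n : nat) (q : R) (u : 'rV[R]_n.+1 * R -> R) :
  1 < q ->
  ancient_solution q u ->
  (* for each eps > 0, sup_{Gamma_R x (-oo,-eps]} |u| = o(R) as R -> oo *)
  (forall eps : R, 0 < eps -> forall delta : R, 0 < delta ->
     exists R0 : R, forall Rr : R, R0 <= Rr ->
       forall (x : 'rV[R]_n.+1) (t : R),
         0 < xlast x -> xlast x < Rr -> t <= - eps -> `|u (x, t)| <= delta * Rr) ->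
  exists g : R -> R, forall (x : 'rV[R]_n.+1) (t : R),
    0 < xlast x -> t < 0 -> u (x, t) = g (xlast x).
Proof.
move=> q1 usol sublinear.
(* The profile is read off on the normal axis at time -1. *)
exists (fun r => u (r *: delta_mx 0 ord_max, -1)) => x t x0 t0.
have et1 (t' s : R) : (x, t') + s *: et R n = (x, t' + s).
  by apply: injective_projections; rewrite ?space_line_et ?time_line_et.
have -> : u (x, t) = u (x, -1).
  (* [time_invariance] moves forward only, so the earlier of t and -1 is the base point. *)
  have [t1|t1] := leP (-1) t.
    have -> : (x, t) = (x, -1) + (t + 1) *: et R n by rewrite et1; congr pair; ring.
    apply: (time_invariance q1 usol sublinear); [split|..]; rewrite /=; lra.
  have -> : (x, -1) = (x, t) + (-1 - t) *: et R n by rewrite et1; congr pair; ring.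
  by symmetry; apply: (time_invariance q1 usol sublinear); [split|..]; rewrite /=; lra.
pose p : 'rV[R]_n.+1 * R := (xlast x *: delta_mx 0 ord_max, -1).
have pQ : Qset p by split; rewrite /= ?ltrN10 // /xlast !mxE !eqxx mulr1.
rewrite -/p -(tangential_sum q1 usol sublinear (fun i => x 0 i) pQ); congr u.
have fstE : (\sum_(i < n.+1 | i != ord_max) x 0 i *: ex R i).1 =
    \sum_(i < n.+1 | i != ord_max) x 0 i *: delta_mx 0 i :> 'rV[R]_n.+1.
  exact: (big_morph fst).
have sndE : (\sum_(i < n.+1 | i != ord_max) x 0 i *: ex R i).2 = 0.
  by rewrite (big_morph snd (id1 := 0) (op1 := +%R)) // big1 // => i _; rewrite /= scaler0.
apply: injective_projections; last by rewrite /= sndE addr0.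
by rewrite /= fstE {1}[x]row_sum_delta (bigD1 ord_max).
Qed.
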